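(* The following are equivalent: (1) NCF (Near Coherence of Filters): every two nonprincipal ultrafilters on $\omega$ nearly cohere. (2) $\mathbb H^*$ has exactly one composant. (3) $\mathbb H^*$ has no coastal points and no non-block points.
   Context: A continuum is a compact connected Hausdorff space. A semicontinuum is a space $T$ such that any two points $a,b\in T$ lie in some continuum $K\subset T$. The continuum components of a Hausdorff space are its maximal continuumwise connected subspaces (maximal semicontinua). For a continuum $X$ and $p\in X$, the composant $\kappa(p)$ is the union of all proper subcontinua of $X$ that include $p$; a composant of $X$ is a set of this form. For distinct $x,p\in X$, $\kappa(x;p)$ denotes the continuum component of $x$ in $X-p$. The point $x\in X$ is coastal if $\kappa(x;p)$ is dense in $X$ for some $p\in X$ (equivalently, $x$ lies in a dense proper semicontinuum of $X$). The point $p\in X$ is a non-block point if $\kappa(x;p)$ is dense in $X$ for some $x\in X$. $\mathbb H=\{x\in\mathbb R:x\ge0\}$ and $\mathbb H^*$ is its Stone–Čech remainder $\beta\mathbb H\setminus\mathbb H$, which is a continuum. For $g\colon\omega\to\omega$ and an ultrafilter $\mathcal D$ on $\omega$, $g(\mathcal D)=\{E\subset\omega:g^{-1}(E)\in\mathcal D\}$. Write $\mathcal E\le\mathcal D$ if $\mathcal E=f(\mathcal D)$ for some monotone finite-to-one $f\colon\omega\to\omega$. Two nonprincipal ultrafilters nearly cohere if they have a common lower bound with respect to $\le$ among nonprincipal ultrafilters. *)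

(* Defs.v *)
From HB Require Import structures.
From mathcomp Require Import all_boot all_order all_algebra.
From mathcomp Require Import all_classical all_reals all_analysis.

Import Order.TTheory GRing.Theory Num.Theory.
Import numFieldNormedType.Exports.

Local Open Scope classical_set_scope.
Local Open Scope ring_scope.

Section Continua.
Context {T : topologicalType}.
Implicit Types (K C S Y : set T) (x p : T).

(* [set_type K] carries the subspace topology of [K]. *)
Definition continuum K : Prop :=
  [/\ compact K, connected K & hausdorff_space (set_type K)].

Definition semicontinuum S : Prop :=
  forall a b, S a -> S b ->
    exists K, [/\ continuum K, K `<=` S, K a & K b].

(* [C] is maximal among the semicontinua contained in [Y]. *)
Definition continuum_component Y C : Prop :=
  [/\ semicontinuum C, C `<=` Y &
      forall S, semicontinuum S -> S `<=` Y -> C `<=` S -> S = C].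

Definition composant p : set T :=
  \bigcup_(K in [set K | [/\ continuum K, K <> setT & K p]]) K.

Definition is_composant C : Prop := exists p, C = composant p.

(* When [T] is Hausdorff and [x <> p] exactly one continuum component of
   [T - p] contains [x], so this union is that component. *)
Definition kappa x p : set T :=
  \bigcup_(C in [set C | continuum_component (~` [set p]) C /\ C x]) C.

Definition coastal x : Prop := exists2 p, x <> p & dense (kappa x p).

Definition non_block p : Prop := exists2 x, x <> p & dense (kappa x p).

End Continua.

Section StoneCech.
Context (R : realType) (X : topologicalType).

Definition unit_fun : set (X -> R) :=
  [set f : X -> R | continuous f /\ forall x, 0 <= f x <= 1].

Definition unit_cube : topologicalType :=
  prod_topology (fun _ : set_type unit_fun => R).

Definition stone_cech_eval (x : X) : unit_cube := fun f => set_val f x.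

(* For completely regular Hausdorff [X], [stone_cech_eval] is an embedding and
   the closure of its image is the Stone-Cech compactification of [X]; it lies
   in [0, 1]^C(X, [0, 1]), so taking the closure in the larger product of
   copies of [R] makes no difference. *)
Definition stone_cech : set unit_cube := closure (range stone_cech_eval).

Definition stone_cech_remainder : set unit_cube :=
  stone_cech `\` range stone_cech_eval.

End StoneCech.

Definition half_line (R : realType) : set R := [set x | 0 <= x].

Definition Hstar (R : realType) : topologicalType :=
  set_type (stone_cech_remainder R (set_type (half_line R))).

Section NearCoherence.
Implicit Types D E : set_system nat.

Definition nonprincipal_ultrafilter D : Prop :=
  UltraFilter D /\ forall n, D <> principal_filter n.

(* [f @ D] is the image filter: [A] belongs to it iff [f @^-1` A] is in [D]. *)
Definition ultrafilter_le E D : Prop :=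
  exists f : nat -> nat,
    [/\ {homo f : m n / (m <= n)%N},
        forall n, finite_set (f @^-1` [set n]) &
        E = f @ D].

Definition nearly_cohere D E : Prop :=
  exists F, [/\ nonprincipal_ultrafilter F,
                ultrafilter_le F D & ultrafilter_le F E].

Definition near_coherence_of_filters : Prop :=
  forall D E, nonprincipal_ultrafilter D -> nonprincipal_ultrafilter E ->
    nearly_cohere D E.

End NearCoherence.

(* Main.v *)
Require Import Defs.
From mathcomp Require Import all_boot all_order all_algebra.
From mathcomp Require Import all_classical all_reals all_analysis.
From mathcomp Require Import wochoice zify lra.

(** A point of the remainder H* is the limit of a free ultrafilter on the
    half-line H, one that contains no bounded set ([Hstar_ultra],
    [Hstar_limit]).  A monotone surjection h of the natural numbers cuts H
    into consecutive blocks, and each nonprincipal ultrafilter F on the set of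
    blocks carries a proper subcontinuum of H*, made of the limits of the
    ultrafilters on H whose block index follows F ([standard_continuum]).
    Conversely, a proper subcontinuum K misses the limits of some open set P
    of H, and this restricts K severely: if Z is a union of intervals with
    endpoints in P, the trace of Z on K is clopen in K, so K lies on one side
    of Z ([connected_cut]).  These two facts turn the topology of H* into
    combinatorics of ultrafilters on the natural numbers.

    From (1) to (2): near coherence of D and E can be witnessed by one block
    map h with h(D) = h(E) ([nearly_cohere_block_map]); hence any two points
    lie in a common standard subcontinuum ([ncf_proper_continuum]), and every
    composant is the whole of H*.

    From (2) back to (1): let x and y be limits of D and E along the integers
    and let K be a proper subcontinuum containing both.  Cutting H at an
    increasing sequence of points of such a set P gives a monotone finite-to-one
    map g, and g(D) = g(E) because K cannot be separated by unions of pieces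
    ([proper_continuum_nearly_cohere]).

    From (1) to the failure of coastality: near coherence excludes Q-points
    ([ncf_not_q_point]), that is, each nonprincipal F has a block map that is
    injective on no set of F.  For points x and p this yields blocks,
    containing both points, in which x is caught between two finer blocks that
    carry p.  A continuum that contains x and misses p misses P as above, with
    P now belonging to the ultrafilter of p, so it can be cut inside the
    blocks on both sides of x; it is therefore trapped in a closed set that
    does not depend on it and is not the whole of H*
    ([ncf_kappa_not_dense]).

    From (3) to (1): if D and E do not nearly cohere, their limits x and p lie
    in no common proper subcontinuum.  The composant of x is then a
    semicontinuum that misses p, and it is dense because standard subcontinua
    through x reach every open set ([proper_continua_dense]).

    The exclusion of Q-points is the deepest step.  Against a Q-point D one
    builds, by transfinite recursion along a family of functions that
    dominates all functions, an ultrafilter that nearly coheres with D by no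
    block map.  The recursion does not get stuck, since at each stage only
    fewer choices have been made than are needed to dominate, while the sets
    of a Q-point can be taken arbitrarily sparse ([near_blocks_avoid]). *)

Set Implicit Arguments.
Unset Strict Implicit.
Unset Printing Implicit Defensive.

Import Order.TTheory GRing.Theory Num.Theory.
Import numFieldNormedType.Exports.

Local Open Scope classical_set_scope.

(** * Well-orders and scales of functions *)

Definition strict_well_order (T : Type) (lt : T -> T -> Prop) : Prop :=
  [/\ well_founded lt, forall x y z, lt x y -> lt y z -> lt x z &
      forall x y, [\/ lt x y, x = y | lt y x]].

Lemma strict_well_order_min (T : Type) (lt : T -> T -> Prop) (A : set T) :
  strict_well_order lt -> A !=set0 ->
  exists2 x, A x & forall y, A y -> ~ lt y x.
Proof.
move=> [wf _ _] [x Ax]; apply: contrapT => none.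
elim/(well_founded_ind wf): x Ax => x IH Ax; apply: none; exists x => // y Ay yx.
exact: IH yx Ay.
Qed.

Lemma strict_well_order_exists (T : Type) :
  exists lt : T -> T -> Prop, strict_well_order lt.
Proof.
have [le wo] := well_ordering_principle ({classic T}).
pose lt (x y : {classic T}) := ~ le y x.
have min (A : {classic T} -> Prop) x : A x -> exists2 z, A z & forall y, A y -> le z y.
  move=> Ax; have [|z [[zA zm] _]] := wo (fun y => `[< A y >]).
    by exists x; apply/asboolP.
  by exists z => [|y Ay]; [exact/asboolP | apply: zm; apply/asboolP].
have anti x y : le x y -> le y x -> x = y.
  move=> xy yx.
  have refl z : le z z by have [? -> + ] := min (fun u => u = z) z erefl; exact.
  have [|z [_ zu]] := wo (fun u => `[< u = x \/ u = y >]).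
    by exists x; apply/asboolP; left.
  rewrite -(zu x); last first.
    by split; [apply/asboolP; left|move=> u /asboolP[->|->]].
  by apply: zu; split; [apply/asboolP; right|move=> u /asboolP[->|->]].
have tot x y : le x y \/ le y x.
  have [z [->|->] zm] := min (fun u => u = x \/ u = y) x (or_introl erefl).
    by left; apply: zm; right.
  by right; apply: zm; left.
exists lt; split.
- move=> x; apply: contrapT => nx.
  have [z nz zm] := min (fun u => ~ Acc lt u) x nx.
  by apply: nz; constructor => y yz; apply: contrapT => /zm.
- move=> x y z xy yz zx.
  have [//|yx] := tot y x; have [//|zy] := tot z y.
  have [u + um] := min (fun u => [\/ u = x, u = y | u = z]) x (Or31 _ _ erefl).
  case=> ue; subst u.
  + have xz := anti _ _ (um z (Or33 _ _ erefl)) zx.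
    by apply: yz; rewrite -xz; exact: um y (Or32 _ _ erefl).
  + exact: xy (um x (Or31 _ _ erefl)).
  + exact: yz (um y (Or32 _ _ erefl)).
- move=> a b; have [xy|nxy] := pselect (le a b); last exact: Or33.
  have [yx|nyx] := pselect (le b a); last exact: Or31.
  by apply: Or32; exact: anti.
Qed.

(** Terms over a set of variables give an index set that absorbs finite
    sequences of indices.  This replaces the cardinal arithmetic that would say
    that an infinite set has as many finite sequences as elements. *)
Inductive term (J : Type) := Cst | Var of J | App of term J & term J.
Arguments Cst {J}.

Fixpoint leaves_in (J : Type) (A : set J) (t : term J) : Prop :=
  match t with
  | Cst => True
  | Var j => A j
  | App a b => leaves_in A a /\ leaves_in A b
  end.

Lemma leaves_inS (J : Type) (A B : set J) t :
  A `<=` B -> leaves_in A t -> leaves_in B t.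
Proof. by move=> AB; elim: t => [|j|a IHa b IHb] //=; [exact: AB | case=> /IHa ? /IHb]. Qed.

Definition dominating (I : Type) (A : set I) (phi : I -> nat -> nat) : Prop :=
  forall psi : nat -> nat, exists2 i, A i &
    exists N, forall n, (N <= n)%N -> (psi n <= phi i n)%N.

Definition has_dominating (I : Type) (A : set I) : Prop :=
  exists phi, dominating A phi.

Lemma has_dominating_surj (I I' : Type) (A : set I) (A' : set I') (f : I' -> I) :
  A `<=` f @` A' -> has_dominating A -> has_dominating A'.
Proof.
move=> sA [phi dom]; exists (phi \o f) => psi.
have [i /sA[i' Ai' <-] phiP] := dom psi; by exists i'.
Qed.

(** Diagonalisation: the successor of the maximum of the first n functions
    at n escapes each of them. *)
Lemma countable_not_dominating : ~ has_dominating [set: nat].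
Proof.
move=> [phi dom].
have [i _ [N /(_ (maxn N i) (leq_maxl _ _))]] :=
  dom (fun n => (\max_(k < n.+1) phi k n).+1).
have im : (i < (maxn N i).+1)%N by rewrite ltnS leq_maxr.
by rewrite ltnNge (leq_bigmax (Ordinal im)).
Qed.

Fixpoint tree_of_term (J : Type) (t : term J) : GenTree.tree unit :=
  match t with
  | Cst => GenTree.Leaf tt
  | Var _ => GenTree.Leaf tt
  | App a b => GenTree.Node 0 [:: tree_of_term a; tree_of_term b]
  end.

Fixpoint term_of_tree (J : Type) (t : GenTree.tree unit) : term J :=
  match t with
  | GenTree.Node _ (a :: b :: _) => App (term_of_tree J a) (term_of_tree J b)
  | _ => Cst
  end.

Lemma closed_term_not_dominating (J : Type) :
  ~ has_dominating [set t : term J | leaves_in set0 t].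
Proof.
move=> dom; apply: countable_not_dominating.
apply: (@has_dominating_surj _ _ _ _
  (fun k => if unpickle k is Some t then term_of_tree J t else Cst) _ dom).
move=> t tc; exists (pickle (tree_of_term t)) => //; rewrite pickleK.
by elim: t tc => [|j|a IHa b IHb] //= [/IHa-> /IHb->].
Qed.

(** Terms over a set A reach all terms over A with one more variable m: the
    constant stands for m, and the former constructors are encoded by
    otherwise unused shapes. *)
Fixpoint plug (J : Type) (m : J) (t : term J) : term J :=
  match t with
  | Cst => Var m
  | Var j => Var j
  | App (App _ a) b => App (plug m a) (plug m b)
  | App _ _ => Cst
  end.

Lemma plug_surj (J : Type) (m : J) (A : set J) :
  [set t | leaves_in (m |` A) t] `<=` plug m @` [set t | leaves_in A t].
Proof.
move=> t /=; elim: t => [_|j [->|Aj]|a IHa b IHb [/IHa[a' a'A <-] /IHb[b' b'A <-]]].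
- by exists (App Cst Cst).
- by exists Cst.
- by exists (Var j).
- by exists (App (App Cst a') b').
Qed.

Fixpoint seq_of_term (J : Type) (t : term J) : seq (term J) :=
  if t is App a b then a :: seq_of_term b else [::].

Fixpoint term_of_seq (J : Type) (s : seq (term J)) : term J :=
  if s is a :: s' then App a (term_of_seq s') else Cst.

Lemma term_of_seqK (J : Type) : cancel (@term_of_seq J) (@seq_of_term J).
Proof. by elim=> //= a s ->. Qed.

Fixpoint all_in (I : Type) (A : set I) (s : seq I) : Prop :=
  if s is i :: s' then A i /\ all_in A s' else True.

Lemma leaves_in_seq (J : Type) (A : set J) (s : seq (term J)) :
  all_in [set t | leaves_in A t] s -> leaves_in A (term_of_seq s).
Proof. by elim: s => //= t s IHs [? /IHs]. Qed.

(** This plays the part of the dominating number: a dominating family indexed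
    by a well-ordered V such that the finite sequences from a proper initial
    segment index no dominating family.  Well-order all functions and keep
    the functions whose closed initial segments carry no dominating family of
    terms; terms over them are ordered first by their largest variable and
    then arbitrarily, so that the terms preceding a given one involve only
    variables up to its largest.  Adding one variable does not create a
    dominating family, by [plug_surj]; hence the terms over the functions that
    are kept do dominate: either all functions are kept, or the kept ones fill
    the initial segment below the first function that fails. *)
Lemma dominating_scale : exists (W : Type) (V : set W) (lt : W -> W -> Prop),
  [/\ strict_well_order lt, has_dominating V &
      forall w, V w ->
        ~ has_dominating [set s | all_in [set v | V v /\ lt v w] s]].
Proof.
have [ltJ woJ] := strict_well_order_exists (nat -> nat).
have [wfJ trJ toJ] := woJ.
pose W := term (nat -> nat).
pose le i j := i = j \/ ltJ i j.
pose below (A : set (nat -> nat)) : set W := [set t | leaves_in A t].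
pose small j := ~ has_dominating (below [set i | le i j]).
pose Js : set (nat -> nat) := [set j | forall i, le i j -> small i].
have le_lt i j k : le i j -> ltJ j k -> ltJ i k by move=> [->//|]; exact: trJ.
have lt_le i j k : ltJ i j -> le j k -> ltJ i k by move=> ij [<-//|]; exact: trJ.
have smallE j : has_dominating (below [set i | le i j]) ->
    has_dominating (below [set i | ltJ i j]).
  apply: (@has_dominating_surj _ _ _ _ (plug j)) => t tb; apply: plug_surj.
  by apply: leaves_inS tb => i [->|]; [left|right].
have [|bot _ botP] := @strict_well_order_min _ _ [set: nat -> nat] woJ.
  by exists id.
have le_total i j : ~ ltJ j i -> le i j.
  by move=> ji; have [|->|//] := toJ i j; [right|left].
have Jsbot : Js bot.
  move=> i [->|/(botP i I)//]; move=> /smallE dom.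
  apply: (@closed_term_not_dominating (nat -> nat)).
  apply: (@has_dominating_surj _ _ _ _ id _ dom) => t tb; exists t => //.
  by apply: leaves_inS tb => k /(botP k I).
have domJs : has_dominating (below Js).
  have [Jall|/existsNP[j jJs]] := pselect (forall j, Js j).
    exists (fun t => if t is Var j then j else id) => psi.
    by exists (Var psi) => /=; [exact: Jall | exists 0%N].
  have [|j0 nsj0 j0min] := @strict_well_order_min _ _ [set i | ~ small i] woJ.
    by move: jJs => /existsNP[i /not_implyP[_ ?]]; exists i.
  have /contrapT/smallE := nsj0.
  apply: (@has_dominating_surj _ _ _ _ id) => t tb; exists t => //.
  apply: leaves_inS tb => i ij k ki; apply: contrapT => nk.
  exact: (j0min _ nk (le_lt _ _ _ ki ij)).
pose top : W -> (nat -> nat) := fix top t := match t with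
  | Cst => bot | Var j => j
  | App a b => if `[< ltJ (top a) (top b) >] then top b else top a end.
have topP t : leaves_in [set i | le i (top t)] t.
  elim: t => [|j|a IHa b IHb] //=; first by left.
  case: asboolP => ab; split.
  - by apply: leaves_inS IHa => i /= ia; right; exact: le_lt ia ab.
  - exact: IHb.
  - exact: IHa.
  - apply: leaves_inS IHb => i /= [->|ib]; first exact: le_total.
    by right; exact: lt_le ib (le_total _ _ ab).
have topJs t : below Js t -> Js (top t).
  by elim: t => [|j|a IHa b IHb] //= [/IHa ? /IHb ?]; case: asboolP.
have [lt1 wo1] := strict_well_order_exists W.
have [wf1 tr1 to1] := wo1.
pose lt (t u : W) := ltJ (top t) (top u) \/ top t = top u /\ lt1 t u.
exists W, (below Js), lt; split; [|exact: domJs|].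
- split.
  + move=> t; move e : (top t) => j.
    elim/(well_founded_ind wfJ): j t e => j IHj t.
    elim/(well_founded_ind wf1): t => t IHt e.
    constructor => u [ut|[ut ut1]]; first by apply: (IHj (top u)); rewrite -?e.
    by apply: IHt; rewrite // ut.
  + move=> t u v [tu|[tu tu1]] [uv|[uv uv1]].
    * by left; exact: trJ tu uv.
    * by left; rewrite -uv.
    * by left; rewrite tu.
    * by right; split; [rewrite tu | exact: tr1 tu1 uv1].
  + move=> t u.
    have [tu|e|ut] := toJ (top t) (top u); first by apply: Or31; left.
      have [tu|tu|ut] := to1 t u; first by apply: Or31; right.
        exact: Or32.
      by apply: Or33; right.
    by apply: Or33; left.
- move=> w wJs; have sw := topJs _ wJs (top w) (or_introl erefl).
  move=> dom; apply: sw.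
  apply: (@has_dominating_surj _ _ _ _ (@seq_of_term _) _ dom) => s ss.
  exists (term_of_seq s); rewrite ?term_of_seqK //; apply: leaves_in_seq.
  elim: s ss => //= v s IHs [[_ vw] /IHs ss]; split=> //.
  apply: leaves_inS (topP v) => i /= iv.
  by case: vw => [vw|[<- _]] //; right; exact: le_lt iv vw.
Qed.

(** * Ultrafilters and block maps *)

Lemma ultra_fmap (T U : Type) (f : T -> U) (F : set_system T) :
  UltraFilter F -> UltraFilter (f @ F).
Proof.
move=> FU; split=> [|G PG sFG]; first exact: fmap_proper_filter.
apply/seteqP; split=> // A GA; rewrite /= /fmap /mkset.
have [//|FA] := in_ultra_setVsetC (f @^-1` A) FU.
have /(filterI GA) : G (~` A) by apply: sFG.
by rewrite setICr => /(@filter_not_empty _ _ PG).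
Qed.

Lemma ultraC (T : Type) (F : set_system T) (A : set T) :
  UltraFilter F -> F (~` A) <-> ~ F A.
Proof.
move=> FU; have FP : ProperFilter F := ultra_proper.
split=> [FnA FA|FA].
  by apply: (@filter_not_empty _ F); rewrite -(setICr A); exact: filterI.
by have [] := in_ultra_setVsetC A FU.
Qed.

Lemma ultra_ext (T : Type) (F G : set_system T) :
  UltraFilter F -> UltraFilter G -> F `<=` G -> F = G.
Proof. by move=> FU GU /max_filter ->. Qed.

(** An ultrafilter of indices lifts along any map whose image, restricted to
    Z, meets every set of that ultrafilter. *)
Lemma ultra_lift (X : Type) (g : X -> nat) (F : set_system nat) (Z : set X) :
  UltraFilter F -> (forall B, F B -> exists2 t, Z t & B (g t)) ->
  exists U : set_system X, [/\ UltraFilter U, U Z & g @ U = F].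
Proof.
move=> FU FZ; pose G : set_system X :=
  [set C | exists2 B, F B & Z `&` g @^-1` B `<=` C].
have GP : ProperFilter G.
  split; last split.
  - by move=> [B FB BC]; have [t Zt Bt] := FZ B FB; exact: (BC t).
  - by exists setT => //; exact: filterT.
  - move=> C D [B FB BC] [B' FB' BD]; exists (B `&` B'); first exact: filterI.
    by move=> t [Zt [Bt B't]]; split; [apply: BC|apply: BD].
  - by move=> C D CD [B FB BC]; exists B => //; exact: subset_trans CD.
have [U [UU sGU]] := ultraFilterLemma GP; exists U; split=> //.
  by apply: sGU; exists setT; [exact: filterT | move=> t []].
apply/esym/ultra_ext => [|B FB]; first exact: ultra_fmap.
suff : U (g @^-1` B) by [].
by apply: sGU; exists B => // t [].
Qed.

(** A monotone surjection amounts to a partition of the natural numbers into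
    consecutive finite intervals, the blocks. *)
Definition block_map (h : nat -> nat) : Prop :=
  {homo h : m n / (m <= n)%N} /\ forall m, exists n, h n = m.

Lemma block_map_lt (h : nat -> nat) m n : block_map h -> (h m < h n)%N -> (m < n)%N.
Proof. by move=> [hh _]; rewrite !ltnNge; apply: contra => /hh. Qed.

Lemma block_map_bound (h : nat -> nat) m : block_map h ->
  exists b, forall n, (h n <= m)%N -> (n < b)%N.
Proof.
move=> hb; have [_ /(_ m.+1)[b hbm]] := hb.
by exists b => n; rewrite -ltnS -hbm; exact: block_map_lt.
Qed.

Lemma block_map_half h : block_map h -> block_map (fun n => (h n)./2).
Proof.
move=> [hh ho]; split=> [m n /hh /half_leq//|m].
by have [n hn] := ho m.*2; exists n; rewrite hn doubleK.
Qed.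

Lemma block_map_uphalf h : block_map h -> block_map (fun n => uphalf (h n)).
Proof.
move=> [hh ho]; split=> [m n /hh ?|m]; first by rewrite !uphalfE half_leq.
by have [n hn] := ho m.*2; exists n; rewrite hn uphalf_double.
Qed.

Lemma block_map_comp h1 h2 : block_map h1 -> block_map h2 ->
  block_map (fun n => h2 (h1 n)).
Proof.
move=> [hh1 ho1] [hh2 ho2]; split=> [m n /hh1 /hh2//|m].
by have [k <-] := ho2 m; have [n <-] := ho1 k; exists n.
Qed.

(** Choose the breakpoints so that each exceeds every value of psi below the
    previous one; then psi moves a point at most one block to the right. *)
Lemma block_map_exists (psi : nat -> nat) :
  exists2 h, block_map h & forall n, (h (psi n) <= (h n).+1)%N.
Proof.
pose k := fix k i := if i is i'.+1
  then (k i' + \max_(n < k i') psi n).+1 else 0%N.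
have k_lt i : (k i < k i.+1)%N by rewrite /= ltnS leq_addr.
have k_homo i j : (i <= j)%N -> (k i <= k j)%N.
  move=> /subnK <-; elim: (j - i)%N => // d IH.
  by rewrite addSn (leq_trans IH)// ltnW.
have k_ge i : (i <= k i)%N by elim: i => // i IH; exact: leq_ltn_trans IH (k_lt i).
have k_psi n i : (n < k i)%N -> (psi n < k i.+1)%N.
  move=> ni; rewrite /= ltnS; apply: leq_trans (leq_addl _ _).
  exact: (leq_bigmax (Ordinal ni)).
have ex n : exists i, (n < k i.+1)%N by exists n; exact: k_ge.
exists (fun n => ex_minn (ex n)); [split|] => [m n mn|m|n].
- case: (ex_minnP (ex n)) => i ni _; case: ex_minnP => j _; apply.
  exact: leq_ltn_trans mn ni.
- exists (k m); case: ex_minnP => j mj jm; apply/eqP; rewrite eqn_leq jm//=.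
  by rewrite leqNgt; apply: contraL mj => jm'; rewrite -leqNgt k_homo.
- case: (ex_minnP (ex n)) => i ni _; case: ex_minnP => j _; apply; exact: k_psi.
Qed.

Lemma finite_set_nat_bound (A : set nat) :
  finite_set A -> exists b, forall n, A n -> (n <= b)%N.
Proof.
move=> /finite_seqP[s ->]; exists (\max_(i <- s) i) => n /= ns.
by rewrite (big_rem n)//= leq_maxl.
Qed.

Lemma nonprincipal_ultrafilterP (D : set_system nat) :
  nonprincipal_ultrafilter D <->
  UltraFilter D /\ forall N, D [set n | (N <= n)%N].
Proof.
split=> -[DU Dn]; split=> //.
- have D1 n : ~ D [set n].
    move=> Dn1; apply: (Dn n); apply/esym; apply: ultra_ext => //.
      exact: principal_filter_ultra.
    by move=> A An; apply: filterS Dn1 => _ ->; exact: An.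
  elim=> [|N IHN]; first by apply: filterS filterT.
  have /(ultraC _ DU) := D1 N; apply: filterS2 IHN => n /= Nn.
  by move=> /eqP nN; rewrite ltn_neqAle eq_sym nN.
- move=> n Dpn; have := Dn n.+1; rewrite Dpn => /principal_filterP /=.
  by rewrite ltnn.
Qed.

Lemma block_map_nonprincipal h D :
  block_map h -> nonprincipal_ultrafilter D -> nonprincipal_ultrafilter (h @ D).
Proof.
move=> hb /nonprincipal_ultrafilterP[DU DN]; apply/nonprincipal_ultrafilterP.
split=> [|N]; first exact: ultra_fmap.
case: N => [|N]; first by apply: filterS filterT.
have [b bP] := block_map_bound N hb.
suff : D [set n | (N < h n)%N] by [].
apply: filterS (DN b) => n /= bn.
by rewrite ltnNge; apply/negP => /bP; rewrite ltnNge bn.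
Qed.

Lemma ultra_parity (D : set_system nat) (h : nat -> nat) : UltraFilter D ->
  exists r : bool, D [set n | odd (h n) = r].
Proof.
move=> DU; have [?|h0] := in_ultra_setVsetC [set n | odd (h n) = true] DU.
  by exists true.
by exists false; apply: filterS h0 => n /= /negP/negbTE.
Qed.

(** If F = f(D) = g(E), the fibres of f and of g over the same m may be far
    apart.  Take blocks so long that each union of two such fibres meets at
    most two consecutive blocks.  The parity of the first block met is constant
    on a set of F, and merging the blocks in pairs according to that parity
    puts both fibres inside one block. *)
Lemma nearly_cohere_block_map (D E : set_system nat) :
  nonprincipal_ultrafilter D -> nonprincipal_ultrafilter E ->
  nearly_cohere D E -> exists2 h, block_map h & h @ D = h @ E.
Proof.
move=> [DU _] [EU _] [F [[FU _] [f [_ fin_f Ff]] [g [_ fin_g Fg]]]].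
(* J m is the union of the two fibres over m, and j m the first block it
   meets. *)
pose J m n := f n = m \/ g n = m.
have Jb m : exists b, forall n, J m n -> (n <= b)%N.
  have [b bP] := finite_set_nat_bound (fin_f m).
  have [c cP] := finite_set_nat_bound (fin_g m).
  by exists (maxn b c) => n [/bP|/cP] nb; rewrite leq_max nb ?orbT.
have /choice[B BP] := Jb.
have [h hb hpsi] := block_map_exists (fun n => maxn (B (f n)) (B (g n))).
have /choice[j jP] m : exists j, forall n, J m n -> h n = j \/ h n = j.+1.
  have [[n0 Jn0]|none] := pselect (exists n, J m n); last first.
    by exists 0%N => n Jn; case: none; exists n.
  have ex : exists n, `[< J m n >] by exists n0; apply/asboolP.
  case: (ex_minnP ex) => n1 /asboolP Jn1 n1min; exists (h n1) => n Jn.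
  have n1n : (n1 <= n)%N by apply: n1min; apply/asboolP.
  have hn1n : (h n1 <= h n)%N by case: hb => + _; exact.
  have : (h n <= (h n1).+1)%N.
    apply: leq_trans (hpsi n1); case: hb => + _; apply.
    by rewrite leq_max; case: Jn1 => ->; rewrite (BP _ _ Jn) ?orbT.
  by rewrite leq_eqVlt ltnS => /orP[/eqP|hn]; [right|left; apply/eqP; rewrite eqn_leq hn].
have key c h' r : block_map h' -> F [set m | odd (j m) = r] ->
    (forall m n, odd (j m) = r -> J m n -> h' n = c m) ->
    exists2 h, block_map h & h @ D = h @ E.
  move=> h'b Fr cP; exists h' => //.
  have eqF (u : nat -> nat) G : UltraFilter G -> F = u @ G ->
      (forall n, J (u n) n) -> h' @ G = c @ F.
    move=> GU Fu Ju; apply: ultra_ext => [||A /= GA]; [exact: ultra_fmap..|].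
    rewrite /fmap /mkset Fu /= /fmap /mkset /=.
    move: Fr; rewrite Fu => Gr; apply: filterS2 GA Gr => n /= h'A r_n.
    by rewrite -(cP _ n r_n).
  by rewrite (eqF f D)// ?(eqF g E)// => n; [right|left].
have [r Fr] := ultra_parity j FU; case: r Fr => Fr.
- apply: (key (fun m => uphalf (j m)) _ true (block_map_uphalf hb)) => // m n jm.
  by move=> /jP[->//|->]; rewrite /= [in RHS]uphalf_half jm add1n.
- apply: (key (fun m => (j m)./2) _ false (block_map_half hb)) => // m n jm.
  by move=> /jP[->//|->]; rewrite -uphalfE uphalf_half jm.
Qed.

(** * Near coherence excludes Q-points *)

(** Transfinite recursion with arbitrary choices, for requirements on the
    value at w that look only at the values below w. *)
Lemma well_founded_choice (W B : Type) (b0 : B) (lt : W -> W -> Prop)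
    (P : W -> (W -> B) -> B -> Prop) :
  well_founded lt ->
  (forall w g g' b, (forall v, lt v w -> g v = g' v) -> P w g b -> P w g' b) ->
  (forall w g, exists b, P w g b) -> exists f, forall w, P w f (f w).
Proof.
move=> wf Ploc Pex.
have /choice[F FP] : forall wg : W * (W -> B), exists b, P wg.1 wg.2 b.
  by move=> [w g]; exact: Pex.
pose ext w (rec : forall v, lt v w -> B) v :=
  if pselect (lt v w) is left vw then rec v vw else b0.
pose f := Fix wf (fun=> B) (fun w rec => F (w, ext w rec)).
have fE w : f w = F (w, ext w (fun v _ => f v)).
  rewrite /f Fix_eq // => v g g' gg'; congr (F (_, _)).
  by apply/funext => u; rewrite /ext; case: pselect.
exists f => w; rewrite [f w in X in P _ _ X]fE.
apply: Ploc (FP (w, ext w (fun v _ => f v))) => v vw /=.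
by rewrite /ext; case: pselect.
Qed.

(** The neighbouring blocks are included because a block shorter than those of
    h may still straddle a breakpoint of h. *)
Definition near_blocks (h : nat -> nat) (A : set nat) : set nat :=
  [set k | exists2 a, A a & (h k <= (h a).+1)%N /\ (h a <= (h k).+1)%N].

Definition coinfinite (S : set nat) : Prop :=
  forall n, exists2 m, (n <= m)%N & ~ S m.

Definition sparse (psi : nat -> nat) (A : set nat) : Prop :=
  forall a b, A a -> A b -> (a < b)%N -> (psi a < b)%N.

(** Suppose that each A in D has an i for which the blocks near A
    absorb the complement of S i, up to a finite set.  Then any two points of
    that complement that are three blocks apart lie near different points of
    A, the second of which exceeds any prescribed function of the first when A
    is sparse enough.  Searching the complement of S i for two such points thus
    defines a family, indexed by V, that dominates. *)
Lemma near_blocks_avoid (D : set_system nat) h (I : Type) (V : set I)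
    (S : I -> set nat) :
  (forall psi, exists2 A, D A & sparse psi A) -> block_map h ->
  ~ has_dominating V ->
  exists2 A, D A & forall i, V i -> coinfinite (S i) ->
    coinfinite (S i `|` near_blocks h A).
Proof.
move=> Dsparse hb nodom; apply: contrapT => stuck; apply: nodom.
have hmono m n : (m <= n)%N -> (h m <= h n)%N by case: hb => + _; exact.
have /choice[phi phiP] : forall xn : I * nat, exists N, coinfinite (S xn.1) ->
    exists e1 e2, [/\ (xn.2 <= e1)%N /\ ~ S xn.1 e1, ~ S xn.1 e2,
      (h e1 + 3 <= h e2)%N & (h e2 + 2 <= h N)%N].
  move=> [i n]; have [Si|] := pselect (coinfinite (S i)); last by exists 0%N.
  have [e1 ne1 Se1] := Si n.
  have [k hk] : exists k, h k = (h e1 + 3)%N by case: hb => _; exact.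
  have [e2 ke2 Se2] := Si k.
  have [N hN] : exists N, h N = (h e2 + 2)%N by case: hb => _; exact.
  by exists N => _; exists e1, e2; rewrite hN -hk; split=> //; exact: hmono.
exists (fun i n => phi (i, n)) => psi.
have /choice[psi' psi'P] : forall a, exists c, forall k, (h k <= (h a).+1)%N -> (psi k <= c)%N.
  move=> a; have [b bP] := block_map_bound (h a).+1 hb.
  exists (\max_(k < b) psi k) => k /bP kb; exact: (leq_bigmax (Ordinal kb)).
have [A DA Asp] := Dsparse psi'.
apply: contrapT => noti; apply: stuck; exists A => // i Vi Si n0.
apply: contrapT => none; apply: noti; exists i => //; exists n0 => n n0n.
have nbA e : (n0 <= e)%N -> ~ S i e -> near_blocks h A e.
  move=> n0e Se; apply: contrapT => ne; apply: none; exists e => //.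
  by case.
have [e1 [e2 [[/= ne1 Se1] Se2 e12 e2N]]] := phiP (i, n) Si.
have lt_e12 : (e1 < e2)%N by apply: (block_map_lt hb); lia.
have [a Aa [e1a ae1]] := nbA _ (leq_trans n0n ne1) Se1.
have [b Ab [e2b be2]] := nbA _ (leq_trans (leq_trans n0n ne1) (ltnW lt_e12)) Se2.
have ab : (a < b)%N by apply: (block_map_lt hb); lia.
have bN : (b < phi (i, n))%N by apply: (block_map_lt hb); lia.
apply: leq_trans (ltnW bN); apply: leq_trans (ltnW (Asp _ _ Aa Ab ab)).
by apply: psi'P; have := hmono _ _ ne1; lia.
Qed.

(** If every block map is injective on a set of D, then D contains
    arbitrarily sparse sets.  Run through a dominating family indexed by V;
    the index w determines a block map h w, and the choice at w of a
    sparse set A w of D keeps all finite unions of the sets of points near the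
    blocks of A w from being cofinite.  An ultrafilter E that avoids all these
    sets nearly coheres with D by no block map g: some h w has blocks longer than
    those of g, so the blocks of g that meet A w lie, except for finitely many
    points, near the blocks of A w. *)
Lemma ncf_not_q_point (D : set_system nat) :
  near_coherence_of_filters -> nonprincipal_ultrafilter D ->
  exists2 h, block_map h &
    forall A, D A -> exists a b, [/\ A a, A b, (a < b)%N & h a = h b].
Proof.
move=> ncf Dnp; have [DU DN] := (nonprincipal_ultrafilterP D).1 Dnp.
apply: contrapT => Q.
have Dsparse psi : exists2 A, D A & sparse psi A.
  have [h hb hpsi] := block_map_exists psi.
  have [A DA Ainj] : exists2 A, D A & forall a b, A a -> A b -> (a < b)%N -> h a <> h b.
    apply: contrapT => nA; apply: Q; exists h => // A DA.
    apply: contrapT => none; apply: nA; exists A => // a b Aa Ab ab hab.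
    by apply: none; exists a, b.
  have [r Dr] := ultra_parity h DU.
  exists (A `&` [set n | odd (h n) = r]); first exact: filterI.
  move=> a b [Aa /= ar] [Ab /= br] ab; apply: (block_map_lt hb).
  apply: leq_ltn_trans (hpsi a) _.
  have hab : (h a <= h b)%N by case: hb => + _; apply; exact: ltnW.
  have /eqP habn := Ainj _ _ Aa Ab ab.
  have : h b != (h a).+1 by apply/eqP => e; move: br; rewrite e /= ar; case: r {Dr ar}.
  lia.
have [W [V [lt [[wf tr tot] [phi phidom] small]]]] := dominating_scale.
have /choice[h hP] : forall w, exists h, block_map h /\ forall n, (h (phi w n) <= (h n).+1)%N.
  by move=> w; have [h ? ?] := block_map_exists (phi w); exists h.
pose U (A : W -> set nat) := fix U s :=
  if s is w :: s' then U s' `|` near_blocks (h w) (A w) else set0.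
pose below w := [set v | V v /\ lt v w].
have [A AP] : exists A : W -> set nat, forall w, D (A w) /\
    (V w -> forall s, all_in (below w) s -> coinfinite (U A s) ->
      coinfinite (U A s `|` near_blocks (h w) (A w))).
  apply: (@well_founded_choice _ _ set0 lt (fun w A b => D b /\ (V w -> forall s,
    all_in (below w) s -> coinfinite (U A s) ->
      coinfinite (U A s `|` near_blocks (h w) b)))) => // [w A A' b AA' [Db bP]|w A].
    split=> // Vw s sw.
    suff <- : U A s = U A' s by exact: bP.
    by elim: s sw => //= v s IHs [[_ /AA' ->] /IHs ->].
  have [Vw|nVw] := pselect (V w); last by exists setT; split=> //; exact: filterT.
  have [b Db bP] := near_blocks_avoid (U A) Dsparse (hP w).1 (small w Vw).
  by exists b.
(* A finite union is contained in one whose indices are strictly decreasing,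
   and such a union is built up by the requirement on the successive A w. *)
have decr_coinf s : all_in V s -> exists2 s', coinfinite (U A s') & U A s `<=` U A s'.
  pose decr := fix decr s := if s is w :: s'
    then [/\ V w, all_in (below w) s' & decr s'] else True.
  have insert w s' : V w -> decr s' -> exists s'',
      [/\ decr s'', U A s' `|` near_blocks (h w) (A w) `<=` U A s'' &
          forall B : set W, B w -> all_in B s' -> all_in B s''].
    move=> Vw; elim: s' => [_|v s' IHs' [Vv vs' ds']].
      by exists [:: w]; split=> //= B Bw _; split.
    have [wv|->|vw] := tot w v.
    - have [s'' [ds'' sub Bs'']] := IHs' ds'.
      exists (v :: s''); split=> [||B Bw [Bv Bs']] /=.
      + by split=> //; apply: Bs''.
      + move=> n [[Un|vn]|wn]; [left|by right|left]; apply: sub; [by left|by right].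
      + by split=> //; exact: Bs''.
    - exists (v :: s'); split=> // n [//|vn]; by right.
    - exists (w :: v :: s'); split=> //; split=> //=; split=> //.
      by elim: (s') vs' => //= u s1 IHs1 [[Vu uv] /IHs1]; split=> //; split=> //; exact: tr vw.
  move=> Vs; have [s' [ds' sub]] : exists s', decr s' /\ U A s `<=` U A s'.
    elim: s Vs => [_|w s IHs /= [Vw /IHs[s' [ds' sub]]]]; first by exists [::]; split.
    have [s'' [ds'' sub' _]] := insert w s' Vw ds'; exists s''; split=> //.
    apply: subset_trans sub'; exact: setSU.
  exists s' => //; elim: s' ds' {sub} => [_ n|w s' IHs' /= [Vw ws' /IHs' cs']].
    by exists n.
  by have [_ /(_ Vw _ ws' cs')] := AP w.
pose F : set_system nat := [set B | exists s N, all_in V s /\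
  forall n, (N <= n)%N -> ~ U A s n -> B n].
have UA_cat s t : U A (s ++ t) = U A s `|` U A t.
  by elim: s => [|w s IHs] /=; rewrite ?set0U// IHs setUAC.
have FP : ProperFilter F.
  split; last split.
  - move=> [s [N [/decr_coinf[s' cs' sub] sN]]].
    have [n Nn nU] := cs' N; apply: (sN n Nn) => Un; exact/nU/sub.
  - by exists [::], 0%N.
  - move=> B C [s [N [Vs sB]]] [t [M [Vt tC]]]; exists (s ++ t), (maxn N M).
    split; first by elim: s Vs {sB} => //= w s IHs [? /IHs].
    move=> n; rewrite geq_max UA_cat => /andP[Nn Mn] nst.
    by split; [apply: sB => // ?; apply: nst; left|apply: tC => // ?; apply: nst; right].
  - by move=> B C BC [s [N [Vs sB]]]; exists s, N; split=> // n Nn /(sB n Nn)/BC.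
have [E [EU sFE]] := ultraFilterLemma FP.
have EN N : E [set n | (N <= n)%N] by apply: sFE; exists [::], N; split.
have Enp : nonprincipal_ultrafilter E by apply/nonprincipal_ultrafilterP.
have [g gb gDE] := nearly_cohere_block_map Dnp Enp (ncf _ _ Dnp Enp).
have /choice[psi psiP] : forall n, exists c, forall k, (g k <= g n)%N -> (k < c)%N.
  by move=> n; exact: block_map_bound.
have [w Vw [N Nphi]] := phidom psi.
have [hb hphi] := hP w; have [DAw _] := AP w.
suff : E (near_blocks (h w) (A w)).
  apply/(ultraC _ EU).1/sFE; exists [:: w], 0%N; split=> // n _ nU wn.
  by apply: nU; right.
(* phi w dominates psi beyond N, so a block of g meets at most two
   consecutive blocks of h w there. *)
have hnear k n : (N <= n)%N -> (g k <= g n)%N -> (h w k <= (h w n).+1)%N.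
  move=> Nn gkn; apply: leq_trans (hphi n); have [+ _] := hb; apply.
  exact: leq_trans (ltnW (psiP _ _ gkn)) (Nphi _ Nn).
pose B := g @` (A w `&` [set n | (N <= n)%N]).
have DB : D (g @^-1` B).
  by apply: filterS (filterI DAw (DN N)) => n An; exists n.
have EB : E (g @^-1` B) by have : (g @ D) B by []; rewrite gDE.
apply: filterS (filterI EB (EN N)) => n [[a [Aa Na] gan] Nn].
by exists a => //; split; apply: hnear => //; rewrite gan.
Qed.

Local Open Scope ring_scope.

(** * General topology *)

Lemma set_type_lift (T : Type) (A : set T) (x : T) : A x ->
  exists u : set_type A, set_val u = x.
Proof. by move=> /mem_set Ax; exists (exist (fun y => y \in A) x Ax). Qed.

Lemma set_val_continuous (X : topologicalType) (A : set X) :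
  continuous (@set_val X A).
Proof. by move=> t; exact: initial_continuous. Qed.

Lemma set_type_cvgP (X : topologicalType) (A : set X)
    (F : set_system (set_type A)) (t : set_type A) {FF : Filter F} :
  F --> t <-> @set_val X A @ F --> set_val t.
Proof.
split=> [Ft|Ft].
  exact: cvg_trans (cvg_app _ Ft) (@set_val_continuous _ _ t).
move=> B [/= _ [[C oC <-] Cx]] CB; apply: filterS CB _.
by apply: Ft; exact: open_nbhs_nbhs.
Qed.

Lemma set_type_hausdorff (X : topologicalType) (A : set X) :
  hausdorff_space X -> hausdorff_space (set_type A).
Proof.
move=> hX p q pq; apply: val_inj; apply: (hX) => B C pB qC.
have [z [Bz Cz]] := pq _ _ (@set_val_continuous _ _ p _ pB) (@set_val_continuous _ _ q _ qC).
by exists (set_val z).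
Qed.

(** Otherwise the closures of the neighbourhoods of A cluster at a point of
    B, which regularity separates from A. *)
Lemma compact_closed_separation (X : topologicalType) (A B : set X) :
  regular_space X -> closed A -> compact B -> A `&` B = set0 ->
  exists P, [/\ open P, A `<=` P & closure P `&` B = set0].
Proof.
move=> regX cA cB AB0; apply: contrapT => none.
pose F : set_system X :=
  [set C | exists P, [/\ open P, A `<=` P & closure P `&` B `<=` C]].
have FP : ProperFilter F.
  split; last split.
  - by move=> [P [oP AP PB]]; apply: none; exists P; split=> //; exact/seteqP.
  - by exists setT; split=> //; exact: openT.
  - move=> C D [P [oP AP PC]] [P' [oP' AP' PD]]; exists (P `&` P'); split.
    + exact: openI.
    + by move=> x Ax; split; [apply: AP|apply: AP'].
    + by move=> x [/closureI[xP xP'] Bx]; split; [apply: PC|apply: PD].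
  - by move=> C D CD [P [oP AP PC]]; exists P; split=> //; exact: subset_trans CD.
have [|z [Bz Fz]] := cB F FP.
  by exists setT; split=> [|//|x []//]; exact: openT.
have nAz : (~` A) z by move=> Az; have : (A `&` B) z by []; rewrite AB0.
have zA : nbhs z (~` A) by apply: open_nbhs_nbhs; split=> //; exact: closed_openC.
have [N zN NA] := regX z _ zA.
have FN : F (closure (~` closure N)).
  exists (~` closure N); split.
  - exact/closed_openC/closed_closure.
  - by move=> x Ax /NA.
  - by move=> x [].
have [x [cx Nx]] := Fz _ _ FN (nbhs_interior zN).
have /cx[y [ny /interior_subset Ny]] : nbhs x N°.
  by apply: open_nbhs_nbhs; split=> //; exact: open_interior.
by apply: ny; exact: subset_closure.
Qed.

Lemma connected_open_split (X : topologicalType) (C A B : set X) :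
  connected C -> open A -> open B -> A `&` B = set0 -> C `<=` A `|` B ->
  C `<=` A \/ C `<=` B.
Proof.
move=> cC oA oB AB0 CAB; apply: connected_subset CAB cC.
have disj (A' B' : set X) : open B' -> A' `&` B' = set0 -> closure A' `&` B' = set0.
  move=> oB' AB'; apply/seteqP; split=> // x [cx Bx].
  have [y] := cx _ (open_nbhs_nbhs (conj oB' Bx)).
  by rewrite AB'.
split; first exact: disj.
by rewrite setIC; apply: disj => //; rewrite setIC.
Qed.

(** * Points of the remainder as limits of ultrafilters *)

Section StoneCechLimits.
Context {R : realType}.
Local Notation H := (set_type (half_line R)).
Local Notation cube := (unit_cube R H).
Local Notation ev := (@stone_cech_eval R H).
Local Notation betaH := (@stone_cech R H).

Lemma unit_cube_hausdorff : hausdorff_space cube.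
Proof. by apply: hausdorff_product => f; exact: Rhausdorff. Qed.

Lemma unit_cube_regular : regular_space cube.
Proof. exact: uniform_regular. Qed.

Lemma unit_cube_proj (i : set_type (@unit_fun R H)) :
  continuous (fun x : cube => x i).
Proof. exact: proj_continuous. Qed.

Lemma unit_box_compact : compact [set x : cube | forall i, 0 <= x i <= 1].
Proof.
have := @tychonoff (set_type (@unit_fun R H)) (fun=> R) (fun=> `[0, 1]%classic)
  (fun=> @segment_compact R 0 1).
by [].
Qed.

Lemma unit_cube_cvgP (F : set_system cube) (x : cube) {FF : Filter F} :
  F --> x <-> forall i, (fun y : cube => y i) @ F --> x i.
Proof.
split=> [Fx i|Fx].
  exact: cvg_trans (cvg_app _ Fx) (@unit_cube_proj i x).
apply/cvg_sup => i.
move=> A [/= _ [[B oB <-] Bx]] BA; apply: filterS BA _.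
by apply: (Fx i); exact: open_nbhs_nbhs.
Qed.

Lemma ev_continuous : continuous ev.
Proof.
move=> t; have FF : Filter (ev @ nbhs t) by exact: fmap_filter.
apply: (unit_cube_cvgP (ev t)).2 => i.
by have [ci _] := set_valP i; exact: ci.
Qed.

Lemma stone_cech_box : betaH `<=` [set x : cube | forall i, 0 <= x i <= 1].
Proof.
have /closure_id -> : closed [set x : cube | forall i, 0 <= x i <= 1].
  by apply: compact_closed; [exact: unit_cube_hausdorff | exact: unit_box_compact].
apply: closureS; by move=> _ [t _ <-] i; have [_ /(_ t)] := set_valP i.
Qed.

Lemma stone_cech_compact : compact betaH.
Proof.
exact: subclosed_compact (@closed_closure _ _) unit_box_compact stone_cech_box.
Qed.

Lemma ultra_limit (U : set_system H) : UltraFilter U ->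
  exists2 x, betaH x & ev @ U --> x.
Proof.
move=> UU; have := stone_cech_compact; rewrite compact_ultra => cpt.
have [||x [bx Ux]] := cpt (ev @ U); [exact: ultra_fmap| |by exists x].
apply: (@filterS _ U _ setT) => [t _|]; last exact: filterT.
by apply: subset_closure; exists t.
Qed.

(** Ultrafilters on H converging to x and containing B are exactly the
    ultrafilters containing B and the traces of the neighbourhoods of x. *)
Lemma closure_ultra (B : set_system H) (x : cube) : Filter B ->
  (forall A, B A -> closure (ev @` A) x) ->
  exists U : set_system H, [/\ UltraFilter U, B `<=` U & ev @ U --> x].
Proof.
move=> FB Bx.
pose F : set_system H :=
  [set C | exists A N, [/\ B A, nbhs x N & A `&` ev @^-1` N `<=` C]].
have FP : ProperFilter F.
  split; last split.
  - move=> [A [N [BA xN AN]]]; have [_ [[t At <-] Nt]] := Bx A BA N xN.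
    exact: (AN t).
  - by exists setT, setT; split=> //; exact: filterT.
  - move=> C D [A [N [BA xN NC]]] [A' [M [BA' xM MD]]].
    exists (A `&` A'), (N `&` M); split; [exact: filterI..|].
    by move=> t [[At A't] [Nt Mt]]; split; [apply: NC|apply: MD].
  - move=> C D CD [A [N [BA xN NC]]]; exists A, N; split=> //.
    exact: subset_trans CD.
have [U [UU sFU]] := ultraFilterLemma FP.
exists U; split=> // [A BA|N xN]; apply: sFU.
  by exists A, setT; split; [|exact: filterT | move=> t []].
by exists setT, N; split; [exact: filterT|  | move=> t []].
Qed.

Lemma ultra_closure (A : set H) (x : cube) (U : set_system H) :
  UltraFilter U -> U A -> ev @ U --> x -> closure (ev @` A) x.
Proof.
move=> UU UA Ux N /Ux UN; have {}UN : U (ev @^-1` N) by [].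
have [t [At Nt]] := filter_ex (filterI UA UN).
by exists (ev t); split=> //; exists t.
Qed.

Lemma ultra_limit_unique (U : set_system H) (x y : cube) : UltraFilter U ->
  ev @ U --> x -> ev @ U --> y -> x = y.
Proof. by move=> UU; apply: cvg_unique; exact: unit_cube_hausdorff. Qed.

End StoneCechLimits.

Section Remainder.
Context {R : realType}.
Local Notation H := (set_type (half_line R)).
Local Notation cube := (unit_cube R H).
Local Notation ev := (@stone_cech_eval R H).
Local Notation betaH := (@stone_cech R H).

(** The coordinates of the cube are all continuous functions from H to the
    unit interval, so Urysohn's lemma on the metric space H provides one. *)
Lemma closed_separating_coordinate (A B : set H) :
  closed A -> closed B -> A `&` B = set0 ->
  exists i, (forall t, A t -> ev t i = 0) /\ (forall t, B t -> ev t i = 1).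
Proof.
move=> cA cB AB.
have sep := (@normal_separatorP R H).1 (@pseudometric_normal R H) A B cA cB AB.
have ui : @unit_fun R H (Urysohn (R := R) A B).
  split; first exact: Urysohn_continuous.
  move=> t; have /= := @Urysohn_range _ R A B (Urysohn A B t) (imageT _ _).
  by rewrite in_itv.
have [i iE] := set_type_lift ui.
exists i; rewrite /stone_cech_eval iE; split=> t ?.
- by apply: (Urysohn_sub0 (R := R) sep); exists t.
- by apply: (Urysohn_sub1 (R := R) sep); exists t.
Qed.

Lemma cvg_coord_eq (U : set_system H) (x : cube) i (A : set H) c : UltraFilter U ->
  ev @ U --> x -> U A -> (forall t, A t -> ev t i = c) -> x i = c.
Proof.
move=> UU Ux UA Ac.
have Uxi : (fun t => ev t i) @ U --> x i.
  exact: cvg_trans (cvg_app (fun y : cube => y i) Ux) (@unit_cube_proj R i x).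
have Uc : (fun t => ev t i) @ U --> c.
  apply: cvg_near_cst; exact: filterS UA.
by apply: cvg_unique Uxi Uc; exact: Rhausdorff.
Qed.

(** Disjoint closed subsets of H have disjoint closures in the
    compactification. *)
Lemma closed_separation (A B : set H) (U V : set_system H) (x : cube) :
  closed A -> closed B -> A `&` B = set0 -> UltraFilter U -> UltraFilter V ->
  U A -> V B -> ev @ U --> x -> ev @ V --> x -> False.
Proof.
move=> cA cB AB UU UV UA VB Ux Vx.
have [i [A0 B1]] := closed_separating_coordinate cA cB AB.
have := cvg_coord_eq UV Vx VB B1; rewrite (cvg_coord_eq UU Ux UA A0) => /eqP.
by rewrite eq_sym oner_eq0.
Qed.

Lemma half_line_val_ge0 (t : H) : 0 <= set_val t.
Proof. by have := set_valP t. Qed.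

Lemma half_line_point (r : R) : 0 <= r -> exists t : H, set_val t = r.
Proof. by move=> r0; exact: (@set_type_lift _ (half_line R)). Qed.

Definition free (U : set_system H) : Prop :=
  forall b : R, U [set t | b < set_val t].

Lemma half_line_closed_le (b : R) : closed [set t : H | set_val t <= b].
Proof.
apply: (@closed_comp _ _ (@set_val _ (half_line R)) [set r : R | r <= b]).
  by move=> t _; exact: set_val_continuous.
exact: closed_le.
Qed.

Lemma half_line_closed_ge (b : R) : closed [set t : H | b <= set_val t].
Proof.
apply: (@closed_comp _ _ (@set_val _ (half_line R)) [set r : R | b <= r]).
  by move=> t _; exact: set_val_continuous.
exact: closed_ge.
Qed.

Lemma free_limit_notin_range (U : set_system H) (x : cube) :
  UltraFilter U -> free U -> ev @ U --> x -> ~ range ev x.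
Proof.
move=> UU Uf Ux [t _ tx].
pose b := set_val t.
apply: (@closed_separation [set s | set_val s <= b] [set s | b + 1 <= set_val s]
    (principal_filter t) U x) => //.
- exact: half_line_closed_le.
- exact: half_line_closed_ge.
- by apply/seteqP; split=> // s [/=]; lra.
- exact: principal_filter_ultra.
- by apply/principal_filterP; rewrite /= /b.
- by apply: filterS (Uf (b + 1)) => s /= /ltW.
- rewrite -tx => A At; suff : principal_filter t (ev @^-1` A) by [].
  by apply/principal_filterP; exact: nbhs_singleton At.
Qed.

Lemma remainder_ultra_free (U : set_system H) (x : cube) :
  UltraFilter U -> ~ range ev x -> ev @ U --> x -> free U.
Proof.
move=> UU nx Ux b; have [//|Ub] := in_ultra_setVsetC [set t : H | b < set_val t] UU.
exfalso; apply: nx.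
have := @segment_compact R 0 b; rewrite compact_ultra => /(_ (set_val @ U)).
have vU : UltraFilter (set_val @ U) by exact: ultra_fmap.
move=> /(_ vU)[|r [r0b Ur]].
  suff : U (set_val @^-1` `[0, b]) by [].
  by apply: filterS Ub => t /= /negP; rewrite -leNgt in_itv/= half_line_val_ge0.
have [t tr] : exists t : H, set_val t = r.
  by apply: half_line_point; move: r0b; rewrite /= in_itv/= => /andP[].
have Ut : U --> t by apply/set_type_cvgP; rewrite tr.
exists t => //; apply: (ultra_limit_unique UU _ Ux).
exact: cvg_trans (cvg_app ev Ut) (@ev_continuous R t).
Qed.

Lemma Hstar_ultra (x : Hstar R) :
  exists U : set_system H, [/\ UltraFilter U, free U & ev @ U --> set_val x].
Proof.
have [bx nx] := set_valP x.
have [|U [UU _ Ux]] := @closure_ultra R (globally [set: H]) (set_val x) _.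
  by move=> A AT; apply: closureS bx => _ [t _ <-]; exists t => //; exact: AT.
by exists U; split=> //; exact: remainder_ultra_free nx Ux.
Qed.

Lemma Hstar_limit (U : set_system H) : UltraFilter U -> free U ->
  exists x : Hstar R, ev @ U --> set_val x.
Proof.
move=> UU Uf; have [x bx Ux] := ultra_limit UU.
have rx : stone_cech_remainder R H x.
  by split=> //; exact: free_limit_notin_range Ux.
by have [y yx] := set_type_lift rx; exists y; rewrite yx.
Qed.

End Remainder.

(** * Cutting the half-line *)

Section Cut.
Context {R : realType}.
Local Notation H := (set_type (half_line R)).
Local Notation cube := (unit_cube R H).
Local Notation ev := (@stone_cech_eval R H).

Definition locally_constant_off (P Z : set H) : Prop :=
  forall t, ~ P t -> nbhs t Z \/ nbhs t (~` Z).

(** With the same statement for the complement of Z, this makes Z and its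
    complement separated outside P even in the compactification. *)
Lemma locally_constant_off_closed (P Z : set H) : open P ->
  locally_constant_off P Z -> closed (Z `\` P).
Proof.
move=> oP lc; rewrite -openC openE => t /not_andP nt.
have [Pt|nPt] := pselect (P t).
  by apply: (filterS _ (open_nbhs_nbhs (conj oP Pt))) => s Ps [_].
have [tZ|tZ] := lc t nPt; last by apply: filterS tZ => s nZs [].
by exfalso; case: nt => // -[]; exact: nbhs_singleton tZ.
Qed.

Lemma locally_constant_offC (P Z : set H) :
  locally_constant_off P Z -> locally_constant_off P (~` Z).
Proof. by move=> lc t /lc[]; [right; rewrite setCK|left]. Qed.

(** A coordinate that is 0 on the part of Z outside P and 1 on the rest of
    the complement of P takes only these two values on K, since K misses P;
    it is constant as K is connected. *)
Lemma connected_cut (K : set (Hstar R)) (P Z : set H) (x y : Hstar R)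
    (U V : set_system H) :
  connected K -> open P -> locally_constant_off P Z ->
  (forall z W, K z -> UltraFilter W -> ev @ W --> set_val z -> W (~` P)) ->
  UltraFilter U -> UltraFilter V -> K x -> K y ->
  ev @ U --> set_val x -> ev @ V --> set_val y -> U Z -> V Z.
Proof.
move=> cK oP lc missP UU UV Kx Ky Ux Vy UZ.
have [//|VnZ] := in_ultra_setVsetC Z UV; exfalso.
have [|i [i0 i1]] := closed_separating_coordinate
  (locally_constant_off_closed oP lc)
  (locally_constant_off_closed oP (locally_constant_offC lc)).
  by apply/seteqP; split=> // t [[Zt _] [nZt _]].
pose c (z : Hstar R) := (set_val z : cube) i.
have cc : continuous c.
  move=> z; apply: (@continuous_comp _ _ _ (@set_val _ _) (fun w : cube => w i)).
    exact: set_val_continuous.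
  exact: unit_cube_proj.
have cval z W : K z -> UltraFilter W -> ev @ W --> set_val z ->
    (W Z -> c z = 0) /\ (W (~` Z) -> c z = 1).
  move=> Kz UW Wz; have WP := missP z W Kz UW Wz.
  by split=> WZ; apply: (cvg_coord_eq UW Wz (filterI WZ WP)) => t ?; [apply: i0|apply: i1].
have cx : c x = 0 by apply: (cval x U Kx UU Ux).1.
have cy : c y = 1 by apply: (cval y V Ky UV Vy).2.
have : connected (c @` K).
  by apply: connected_continuous_connected => //; exact: continuous_subspaceT.
move=> /connected_intervalP/(_ 0 1).
have c0 : (c @` K) 0 by exists x.
have c1 : (c @` K) 1 by exists y.
move=> /(_ c0 c1 (1 / 2))[|z Kz cz]; first by apply/andP; split; lra.
have [W [UW _ Wz]] := Hstar_ultra z.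
have [z0 z1] := cval z W Kz UW Wz.
by have [/z0|/z1] := in_ultra_setVsetC Z UW; rewrite cz; lra.
Qed.

Lemma Hstar_hausdorff : hausdorff_space (Hstar R).
Proof. exact/set_type_hausdorff/unit_cube_hausdorff. Qed.

(** By regularity of the cube, q has a neighbourhood whose closure is disjoint
    from K; P is the trace of its interior on H. *)
Lemma closed_missed_by_open (K : set (Hstar R)) (q : Hstar R) :
  closed K -> ~ K q -> exists P : set H, [/\ open P,
    forall V, UltraFilter V -> ev @ V --> set_val q -> V P &
    forall y U, K y -> UltraFilter U -> ev @ U --> set_val y -> U (~` P)].
Proof.
move=> cK nKq; have : open (~` K) by exact: closed_openC.
move=> [G oG GK].
have qG : nbhs (set_val q : cube) G.
  apply: open_nbhs_nbhs; split=> //.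
  by have : (set_val @^-1` G) q by rewrite GK.
have [N qN NG] := @unit_cube_regular R (set_val q) _ qG.
exists (ev @^-1` N°); split.
- apply: open_comp; last exact: open_interior.
  by move=> t _; exact: ev_continuous.
- by move=> V UV Vq; apply: (Vq N°); exact: nbhs_interior qN.
- move=> y U Ky UU Uy; apply/ultraC => UN.
  have yG : G (set_val y).
    apply: NG; have := ultra_closure UU UN Uy.
    apply: closureS => _ [t Nt <-]; exact: interior_subset.
  by have : (~` K) y by rewrite -GK.
Qed.

Definition same_side (c s t : R) : Prop := c < s /\ c < t \/ s < c /\ t < c.

(** Near t only finitely many comparisons with the c k can change, because
    the c k tend to infinity, and none does when t differs from all of them. *)
Lemma locally_constant_compare (Q : set nat) (c : nat -> R) (P Z : set H) :
  (forall b, exists N, forall k, Q k -> c k <= b -> (k < N)%N) ->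
  (forall k t, Q k -> set_val t = c k -> P t) ->
  (forall s t, (forall k, Q k -> same_side (c k) (set_val s) (set_val t)) -> Z s -> Z t) ->
  locally_constant_off P Z.
Proof.
move=> cinf cP Zc t nPt.
have ct k : Q k -> c k != set_val t.
  by move=> Qk; apply/eqP => e; apply: nPt; exact: (cP k).
suff near_t : \forall s \near t, forall k, Q k -> same_side (c k) (set_val s) (set_val t).
  have [Zt|nZt] := pselect (Z t); [left|right]; apply: filterS near_t => s st.
    by apply: Zc Zt => k /st[[]|[]]; [left|right].
  by move=> Zs; apply: nZt; exact: Zc Zs.
have [N NP] := cinf (set_val t + 1).
have near_val (A : set R) : nbhs (set_val t) A -> \forall s \near t, A (set_val s).
  by move=> tA; exact: (@set_val_continuous _ _ t A).
have small : \forall s \near t, set_val s < set_val t + 1.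
  have lt1 : set_val t < set_val t + 1 by lra.
  exact: near_val (lt_nbhsl lt1).
have finite : \forall s \near t, forall k, (k < N)%N -> Q k ->
    same_side (c k) (set_val s) (set_val t).
  elim: N {NP} => [|N IHN]; first by near=> s.
  have [QN|nQN] := pselect (Q N); last first.
    apply: filterS IHN => s sN k; rewrite ltnS leq_eqVlt => /orP[/eqP -> //|]; exact: sN.
  suff sN : \forall s \near t, same_side (c N) (set_val s) (set_val t).
    apply: filterS2 IHN sN => s ks Ns k.
    by rewrite ltnS leq_eqVlt => /orP[/eqP -> _|/ks].
  have [cNt|] := ltP (c N) (set_val t).
    by apply: filterS (near_val _ (lt_nbhsr cNt)) => s ?; left.
  rewrite le_eqVlt eq_sym (negbTE (ct _ QN))/= => tcN.
  by apply: filterS (near_val _ (lt_nbhsl tcN)) => s ?; right.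
apply: filterS2 finite small => s sfin st k Qk.
have [kN|Nk] := ltnP k N; first exact: sfin.
have ckt : set_val t + 1 < c k.
  by rewrite ltNge; apply/negP => /(NP _ Qk); rewrite ltnNge Nk.
by right; split; lra.
Unshelve. all: by end_near. Qed.

End Cut.

(** * Standard subcontinua *)

Section Standard.
Context {R : realType}.
Local Notation H := (set_type (half_line R)).
Local Notation cube := (unit_cube R H).
Local Notation ev := (@stone_cech_eval R H).

Definition block_index (h : nat -> nat) (t : H) : nat :=
  h (Num.truncn (set_val t)).

(** These are the limits of the ultrafilters on H that project to F under the
    block index; with closures, compactness is immediate. *)
Definition standard_continuum h (F : set_system nat) : set (Hstar R) :=
  [set y | forall B, F B -> closure (ev @` (block_index h @^-1` B)) (set_val y)].

Lemma block_index_free h (F : set_system nat) (U : set_system H) : block_map h ->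
  nonprincipal_ultrafilter F -> UltraFilter U -> block_index h @ U = F -> free U.
Proof.
move=> hb /nonprincipal_ultrafilterP[_ FN] UU UF b.
pose N := (Num.truncn b).+1.
have : F [set m | (h N < m)%N] by exact: FN.
rewrite -UF => UN; have {}UN : U (block_index h @^-1` [set m | (h N < m)%N]) by [].
apply: filterS UN => t /= /(block_map_lt hb) Nt.
have /andP[tt _] := Num.Theory.truncn_itv (half_line_val_ge0 t).
apply: lt_le_trans tt; apply: (lt_trans (Num.Theory.truncnS_gt b)).
by rewrite ltr_nat.
Qed.

Lemma standard_continuum_limit h (U : set_system H) (y : Hstar R) :
  UltraFilter U -> ev @ U --> set_val y ->
  standard_continuum h (block_index h @ U) y.
Proof. by move=> UU Uy B UB; exact: ultra_closure Uy. Qed.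

Lemma standard_ultra h (F : set_system nat) (z : cube) : UltraFilter F ->
  (forall B, F B -> closure (ev @` (block_index h @^-1` B)) z) ->
  exists U : set_system H,
    [/\ UltraFilter U, block_index h @ U = F & ev @ U --> z].
Proof.
move=> FU Fz; pose G : set_system H := filter_from F (fun B => block_index h @^-1` B).
have GF : Filter G.
  apply: filter_from_filter; first by exists setT; exact: filterT.
  by move=> B C FB FC; exists (B `&` C); [exact: filterI|].
have [|U [UU GU Uz]] := @closure_ultra R G z GF.
  by move=> A [B FB BA]; apply: closureS (Fz B FB); exact: image_subset.
exists U; split=> //; apply/esym/ultra_ext => [|B FB]; first exact: ultra_fmap.
suff : U (block_index h @^-1` B) by [].
by apply: GU; exists B.
Qed.

(** The same set inside the whole cube, where compactness and separation are
    available; [closures_Hstar] shows that nothing is added outside the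
    remainder. *)
Definition closures h (F : set_system nat) : set cube :=
  [set z | forall B, F B -> closure (ev @` (block_index h @^-1` B)) z].

Lemma closures_closed h F : closed (closures h F).
Proof.
rewrite (_ : closures h F = \bigcap_(B in F) closure (ev @` (block_index h @^-1` B))).
  by apply: closed_bigI => B _; exact: closed_closure.
by apply/seteqP; split=> z /= zF B; exact: zF.
Qed.

Lemma closures_compact h (F : set_system nat) : UltraFilter F -> compact (closures h F).
Proof.
move=> FU; apply: (subclosed_compact (@closures_closed h F) (@stone_cech_compact R)).
move=> z /(_ setT filterT); apply: closureS => _ [t _ <-]; by exists t.
Qed.

Lemma closures_Hstar h (F : set_system nat) z : block_map h ->
  nonprincipal_ultrafilter F -> closures h F z ->
  exists2 y : Hstar R, standard_continuum h F y & set_val y = z.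
Proof.
move=> hb Fnp; have [FU _] := Fnp => /[dup] zF /(standard_ultra FU)[U [UU UF Uz]].
have [y Uy] := Hstar_limit UU (block_index_free hb Fnp UU UF).
by exists y; [|exact: ultra_limit_unique Uy Uz];
  rewrite -UF; exact: standard_continuum_limit.
Qed.

Lemma standard_continuum_compact h F : block_map h ->
  nonprincipal_ultrafilter F -> compact (standard_continuum h F).
Proof.
move=> hb Fnp; have [FU _] := Fnp; rewrite compact_ultra => G GU Gstd.
have := closures_compact (h := h) FU; rewrite compact_ultra => /(_ (set_val @ G)).
have vU : UltraFilter (set_val @ G) by exact: ultra_fmap.
move=> /(_ vU)[|z [zF Gz]].
  suff : G (set_val @^-1` closures h F) by [].
  by apply: filterS Gstd.
have [y ys yz] := closures_Hstar hb Fnp zF; exists y; split=> //=.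
by apply/set_type_cvgP; rewrite yz.
Qed.

Lemma block_connected h m : block_map h ->
  connected (block_index h @^-1` [set m]).
Proof.
move=> [hh _].
have c_ex (r : R) : exists t : H, set_val t = Num.max 0 r.
  by apply: half_line_point; rewrite le_max lexx.
have /choice[c cE] := c_ex.
have cc : continuous c.
  move=> r; have FF : Filter (c @ nbhs r) by exact: fmap_filter.
  apply: (set_type_cvgP (c r)).2; rewrite cE.
  rewrite (_ : set_val @ (c @ nbhs r) = (fun r => Num.max 0 r) @ nbhs r).
    exact: (@continuous_max R R (fun=> 0) id r (@cvg_cst _ _ _ _ _) cvg_id).
  have -> : (fun r => Num.max 0 r) = set_val \o c by apply/funext => s /=; rewrite cE.
  by [].
have -> : block_index h @^-1` [set m] =
    c @` [set r | 0 <= r /\ h (Num.truncn r) = m].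
  apply/seteqP; split=> [t tm|_ [r [r0 rm] <-]]; last first.
    by rewrite /= /block_index cE max_r.
  exists (set_val t); first by split=> //; exact: half_line_val_ge0.
  by apply: val_inj; rewrite -!set_valE cE max_r ?half_line_val_ge0.
apply: connected_continuous_connected; last exact: continuous_subspaceT.
apply/connected_intervalP => r1 r2 [r10 r1m] [_ r2m] r /andP[r1r rr2].
split; first exact: le_trans r1r.
by apply/eqP; rewrite eqn_leq -{1}r2m -r1m !hh//; exact: Num.Theory.le_truncn.
Qed.

(** Blocks are connected and F is an ultrafilter: separate two clopen pieces
    by an open set P.  By compactness F-almost no block meets the boundary of P,
    so each such block lies in P or off its closure, and F decides which of
    the two happens almost always; one of the pieces must then be empty. *)
Lemma standard_continuum_connected h F : block_map h ->
  nonprincipal_ultrafilter F -> connected (standard_continuum h F).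
Proof.
move=> hb Fnp; have [FU _] := Fnp.
move=> B [b Bb] [C oC BC] [C' cC' BC']; rewrite BC.
apply/setIidPl => y Fy; apply: contrapT => nCy.
have [G oG GC] : exists2 G : set cube, open G & set_val @^-1` G = C.
  by case: oC => G oG GC; exists G.
have [G' cG' GC'] : exists2 G' : set cube, closed G' & set_val @^-1` G' = C'.
  have [N oN NC] : open (~` C') by exact: closed_openC.
  exists (~` N); first exact: open_closedC.
  by rewrite -[RHS]setCK -NC.
pose L := closures h F.
have inL z : L z -> exists2 y : Hstar R, standard_continuum h F y & set_val y = z.
  exact: closures_Hstar.
have disj : (L `&` G') `&` (L `&` ~` G) = set0.
  apply/seteqP; split=> // z [[Lz G'z] [_ nGz]].
  have [w Fw wz] := inL z Lz; subst z.
  have : B w by rewrite BC' -GC'.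
  by rewrite BC -GC => -[_ /nGz].
have [||P [oP AP PB]] := @compact_closed_separation cube _ _
    (@unit_cube_regular R) _ _ disj.
- by apply: closedI; [exact: closures_closed|].
- apply: (subclosed_compact _ (closures_compact (h := h) FU)); last by move=> z [].
  by apply: closedI; [exact: closures_closed | exact: open_closedC].
(* Otherwise an ultrafilter following F would concentrate on the boundary of
   P; its limit would be a point of neither piece. *)
have [D FD DP] : exists2 D, F D &
    forall t, D (block_index h t) -> P (ev t) \/ (~` closure P) (ev t).
  apply: contrapT => none.
  have [|U [UU UZ UF]] := @ultra_lift H (block_index h) F
      (ev @^-1` (closure P `\` P)) FU.
    move=> D FD; apply: contrapT => nt; apply: none; exists D => // t Dt.
    have [Pt|nPt] := pselect (P (ev t)); first by left.
    by right => cPt; apply: nt; exists t.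
  have [z zb Uz] := ultra_limit UU.
  have Lz : L z.
    move=> D; rewrite -UF => UD; exact: ultra_closure Uz.
  have zcP : closure P z.
    have /closure_id -> := @closed_closure _ P.
    by apply: closureS (ultra_closure UU UZ Uz) => _ [t [cPt _] <-].
  have znP : ~ P z.
    move=> Pz; have UP : U (ev @^-1` P) by apply: (Uz P); exact: open_nbhs_nbhs.
    by have [t [[_ nPt] Pt]] := filter_ex (filterI UZ UP).
  have [w Fw wz] := inL z Lz; subst z.
  have [Gw|nGw] := pselect (G (set_val w)).
    apply/znP/AP; split=> //; have : B w by rewrite BC -GC.
    by rewrite BC' -GC' => -[].
  by have : (closure P `&` (L `&` ~` G)) (set_val w) by []; rewrite PB.
pose D1 : set nat := [set m | forall t, block_index h t = m -> P (ev t)].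
have blocks m : D m -> D1 m \/
    forall t, block_index h t = m -> (~` closure P) (ev t).
  move=> Dm; have [|||||sub|sub] := @connected_open_split H
    (block_index h @^-1` [set m]) (ev @^-1` P) (ev @^-1` (~` closure P)).
  - exact: block_connected.
  - by apply: open_comp oP => t _; exact: ev_continuous.
  - apply: open_comp; first by move=> t _; exact: ev_continuous.
    exact/closed_openC/closed_closure.
  - by apply/seteqP; split=> // t [Pt]; apply; exact: subset_closure.
  - by move=> t tm; apply: DP; rewrite tm.
  - by left.
  - by right.
have Ly : L (set_val y) by [].
have [FD1|FnD1] := in_ultra_setVsetC D1 FU.
  have nGy : ~ G (set_val y) by move=> Gy; apply: nCy; rewrite -GC.
  suff : (closure P `&` (L `&` ~` G)) (set_val y) by rewrite PB.
  by split=> //; apply: closureS (Ly _ FD1) => _ [t tD <-]; exact: tD.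
have Lb : L (set_val b) by have : B b by []; rewrite BC => -[].
have Pb : P (set_val b).
  by apply: AP; split=> //; have := Bb; rewrite BC' -GC' => -[].
have [_ [[t [Dt nD1t] <-] Pt]] := Lb _ (filterI FD FnD1) _ (open_nbhs_nbhs (conj oP Pb)).
by have [/nD1t|/(_ t erefl)] := blocks _ Dt => //; apply; exact: subset_closure.
Qed.

Lemma cos_2pi_nat (n : nat) : cos (pi *+ 2 * n%:R) = 1 :> R.
Proof.
elim: n => [|n IHn]; first by rewrite mulr0 cos0.
by rewrite -natr1 mulrDr mulr1 cosD2pi.
Qed.

(** A limit of midpoints n + 1/2 of intervals outside the chosen blocks.  The
    function cos (2 pi t) keeps these midpoints away from the integers, and off
    the integers membership in a block is locally constant. *)
Lemma outside_blocks h (G : set nat) : block_map h ->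
  (forall m, exists2 m', (m <= m')%N & ~ G m') ->
  exists y : Hstar R, ~ closure (ev @` (block_index h @^-1` G)) (set_val y).
Proof.
move=> hb Ginf.
pose mid (t : H) := exists n, set_val t = n%:R + 1 / 2 /\ ~ G (h n).
pose F : set_system H := [set A | exists N : nat, forall t, mid t -> N%:R <= set_val t -> A t].
have FP : ProperFilter F.
  split; last split.
  - move=> [N NA]; have [m hm nGm] := Ginf (h N).+1.
    have [n nm] : exists n, h n = m by case: hb => _; exact.
    have [t tn] : exists t : H, set_val t = n%:R + 1 / 2.
      by apply: half_line_point; have := ler0n R n; lra.
    apply: (NA t); first by exists n; rewrite nm.
    have : (N < n)%N by apply: (block_map_lt hb); rewrite nm.
    by rewrite -(ltr_nat R) tn; lra.
  - by exists 0%N.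
  - move=> A B [N NA] [M MB]; exists (maxn N M) => t mt; rewrite natr_max ge_max.
    by move=> /andP[Nt Mt]; split; [apply: NA|apply: MB].
  - by move=> A B AB [N NA]; exists N => t mt /(NA t mt) /AB.
have [V [VU sFV]] := ultraFilterLemma FP.
have Vmid : V mid by apply: sFV; exists 0%N.
have Vfree : free V.
  move=> b; apply: sFV; exists (Num.truncn b).+1 => t _; apply: lt_le_trans.
  exact: Num.Theory.truncnS_gt.
have [y Vy] := Hstar_limit VU Vfree; exists y => cy.
have [|U [UU UG Uy]] := @closure_ultra R (globally (block_index h @^-1` G)) (set_val y) _.
  move=> A GA; apply: closureS cy; exact: image_subset.
have {}UG : U (block_index h @^-1` G) by apply: UG.
pose tau (t : H) : R := cos (pi *+ 2 * set_val t).
have ctau : continuous tau.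
  move=> t; apply: (@continuous_comp _ _ _ (@set_val _ (half_line R))
    (fun r => cos (pi *+ 2 * r))); first exact: set_val_continuous.
  apply: (@continuous_comp _ _ _ (fun r => pi *+ 2 * r) (@cos R)).
    by apply: cvgM; [exact: cvg_cst|exact: cvg_id].
  exact: continuous_cos.
have taumid t : mid t -> tau t = - 1.
  move=> [n [tn _]]; rewrite /tau tn mulrDr.
  have -> : pi *+ 2 * (1 / 2) = pi :> R by rewrite -mulr_natr; lra.
  by rewrite cosDpi cos_2pi_nat.
have trunc_mid t : mid t -> ~ G (block_index h t).
  move=> [n [tn nG]]; rewrite /block_index (@Num.Theory.truncn_def _ _ n)//.
  by rewrite tn -[n.+1%:R]natr1; apply/andP; split; lra.
pose P : set H := [set t | 0 < tau t].
have oP : open P.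
  apply: (@open_comp _ _ tau [set r | 0 < r]); last exact: open_gt.
  by move=> t _; exact: ctau.
have lc : locally_constant_off P (block_index h @^-1` G).
  apply: (@locally_constant_compare R setT (fun n => n%:R)).
  - move=> b; exists (Num.truncn b).+1 => k _ kb.
    by rewrite -(ltr_nat R); apply: le_lt_trans kb (Num.Theory.truncnS_gt b).
  - by move=> k t _ tk; rewrite /P /= /tau tk cos_2pi_nat.
  - move=> s t st; rewrite /= /block_index.
    suff -> : Num.truncn (set_val s) = Num.truncn (set_val t) by [].
    apply: Num.Theory.truncn_def.
    have /andP[t1 t2] := Num.Theory.truncn_itv (half_line_val_ge0 t).
    by have [[]|[]] := st (Num.truncn (set_val t)) I;
      have [[]|[]] := st (Num.truncn (set_val t)).+1 I; lra.
have Pmid t : mid t -> ~ P t by move=> /taumid; rewrite /P /= => ->; lra.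
(* U and V converge to the same point, so tau separates them if P is in U;
   otherwise the blocks do. *)
have [UP|UnP] := in_ultra_setVsetC P UU.
  apply: (@closed_separation R [set t | 0 <= tau t] [set t | tau t <= - 1] U V (set_val y)) => //.
  - apply: (@closed_comp _ _ tau [set r | 0 <= r]); last exact: closed_ge.
    by move=> t _; exact: ctau.
  - apply: (@closed_comp _ _ tau [set r | r <= -1]); last exact: closed_le.
    by move=> t _; exact: ctau.
  - by apply/seteqP; split=> // t [/=]; lra.
  - by apply: filterS UP => t /ltW.
  - by apply: filterS Vmid => t /taumid /= ->.
apply: (@closed_separation R _ _ U V (set_val y)
  (locally_constant_off_closed oP lc)
  (locally_constant_off_closed oP (locally_constant_offC lc))) => //.
- by apply/seteqP; split=> // t [[? _] []].
- exact: filterI.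
- by apply: filterS Vmid => t mt; split; [exact: trunc_mid|exact: Pmid].
Qed.

End Standard.

(** * Continuum components *)

Section Kappa.
Context {T : topologicalType} (hT : hausdorff_space T).

Lemma continuumU (K L : set T) x : continuum K -> continuum L -> K x -> L x ->
  continuum (K `|` L).
Proof.
move=> [cK coK _] [cL coL _] Kx Lx; split; last exact: set_type_hausdorff.
- exact: compactU.
- by apply: connectedU => //; exists x.
Qed.

(** The union of all continua that contain x and miss p is the continuum
    component of x. *)
Lemma continuum_sub_kappa (K : set T) (x p : T) :
  continuum K -> K x -> ~ K p -> K `<=` kappa x p.
Proof.
move=> cK Kx nKp y Ky.
pose C : set T := [set z | exists L, [/\ continuum L, L x, ~ L p & L z]].
exists C; last by exists K.
split; last by exists K.
split.
- move=> a b [L [cL Lx nLp La]] [M [cM Mx nMp Mb]].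
  have cLM := continuumU cL cM Lx Mx.
  exists (L `|` M); split; [exact: cLM|move=> z|by left|by right].
  move=> LMz; exists (L `|` M); split=> //; first by left.
  by case.
- by move=> z [L [_ _ nLp Lz]] zp; apply: nLp; rewrite -zp.
- move=> S semiS Sp CS; apply/seteqP; split=> // s Ss.
  have Sx : S x by apply: CS; exists K.
  have [L [cL LS Lx Ls]] := semiS x s Sx Ss.
  by exists L; split=> // /LS /Sp; apply.
Qed.

Lemma kappa_continuum (x p z : T) : kappa x p z ->
  exists K, [/\ continuum K, K x, K z & ~ K p].
Proof.
move=> [C [[semiC Cp _] Cx] Cz]; have [K [cK KC Kx Kz]] := semiC x z Cx Cz.
by exists K; split=> // /KC /Cp; apply.
Qed.

Lemma continuum_closed (K : set T) : continuum K -> closed K.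
Proof. by move=> [cK _ _]; exact: compact_closed. Qed.

End Kappa.

(** * Composants of the remainder *)

Section Main.
Context {R : realType}.
Local Notation H := (set_type (half_line R)).
Local Notation cube := (unit_cube R H).
Local Notation ev := (@stone_cech_eval R H).

Lemma standard_continuum_continuum h F : block_map h ->
  nonprincipal_ultrafilter F -> continuum (@standard_continuum R h F).
Proof.
move=> hb Fnp; split; last exact/set_type_hausdorff/Hstar_hausdorff.
- exact: standard_continuum_compact.
- exact: standard_continuum_connected.
Qed.

(** The blocks with index of one parity leave out infinitely many blocks, so
    their closure is not everything; an ultrafilter always concentrates on one
    of the two parities. *)
Lemma parity_outside h (r : bool) : block_map h -> exists y : Hstar R,
  ~ closure (ev @` (block_index h @^-1` [set m | odd m = r])) (set_val y).
Proof.
move=> hb; apply: outside_blocks => // m.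
have [mr|mr] := eqVneq (odd m) r.
  by exists m.+1; rewrite //= mr; case: (r).
by exists m => //= /eqP; rewrite (negbTE mr).
Qed.

Lemma standard_continuum_proper h F : block_map h ->
  nonprincipal_ultrafilter F -> @standard_continuum R h F <> setT.
Proof.
move=> hb [FU _] stdT; have [r Fr] := ultra_parity id FU.
have [y nGy] := parity_outside r hb; apply: nGy.
have : standard_continuum h F y by rewrite stdT.
exact.
Qed.

Lemma half_line_truncn_lt h (s t : H) : block_map h ->
  (block_index h s < block_index h t)%N -> set_val s < set_val t.
Proof.
move=> hb /(block_map_lt hb) st; rewrite ltNge; apply: contraL st => ts.
by rewrite -leqNgt; exact: Num.Theory.le_truncn.
Qed.

Lemma free_truncn_nonprincipal (U : set_system H) : UltraFilter U -> free U ->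
  nonprincipal_ultrafilter ((fun t : H => Num.truncn (set_val t)) @ U).
Proof.
move=> UU Uf; apply/nonprincipal_ultrafilterP; split; first exact: ultra_fmap.
move=> N; suff : U [set t | (N <= Num.truncn (set_val t))%N] by [].
apply: filterS (Uf N%:R) => t /= /ltW Nt.
by rewrite Num.Theory.truncn_ge_nat// half_line_val_ge0.
Qed.

Lemma ncf_proper_continuum (x y : Hstar R) : near_coherence_of_filters ->
  exists K : set (Hstar R), [/\ continuum K, K <> setT, K x & K y].
Proof.
move=> ncf.
have [U [UU Uf Ux]] := Hstar_ultra x; have [V [VU Vf Vy]] := Hstar_ultra y.
have Unp := free_truncn_nonprincipal UU Uf.
have Vnp := free_truncn_nonprincipal VU Vf.
have [h hb hUV] := nearly_cohere_block_map Unp Vnp (ncf _ _ Unp Vnp).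
have Fnp := block_map_nonprincipal hb Unp.
exists (standard_continuum h (block_index h @ U)); split.
- exact: standard_continuum_continuum.
- exact: standard_continuum_proper.
- exact: standard_continuum_limit.
- have -> : block_index h @ U = block_index h @ V by exact: hUV.
  exact: standard_continuum_limit.
Qed.

Lemma block_map_id : block_map id.
Proof. by split=> // m; exists m. Qed.

Lemma proper_continuum_containing (x : Hstar R) :
  exists K : set (Hstar R), [/\ continuum K, K <> setT & K x].
Proof.
have [U [UU Uf Ux]] := Hstar_ultra x.
have Fnp : nonprincipal_ultrafilter (block_index id @ U).
  exact: free_truncn_nonprincipal.
exists (standard_continuum id (block_index id @ U)); split.
- exact: (standard_continuum_continuum block_map_id).
- exact: (standard_continuum_proper block_map_id).
- exact: standard_continuum_limit.
Qed.

Lemma integer_embedding : exists pt : nat -> H, forall n, set_val (pt n) = n%:R.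
Proof.
have /choice[pt ptE] n : exists t : H, set_val t = n%:R.
  by apply: half_line_point; exact: ler0n.
by exists pt.
Qed.

Section Integers.
Context (pt : nat -> H) (ptE : forall n, set_val (pt n) = n%:R).

Lemma integer_free D : nonprincipal_ultrafilter D -> free (pt @ D).
Proof.
move=> /nonprincipal_ultrafilterP[DU DN] b.
suff : D [set n | b < set_val (pt n)] by [].
apply: filterS (DN (Num.truncn b).+1) => n /= bn; rewrite ptE.
apply: lt_le_trans (Num.Theory.truncnS_gt b) _; by rewrite ler_nat.
Qed.

Lemma integer_limit D : nonprincipal_ultrafilter D ->
  exists x : Hstar R, ev @ (pt @ D) --> set_val x.
Proof.
move=> Dnp; have [DU _] := Dnp.
by apply: Hstar_limit; [exact: ultra_fmap | exact: integer_free].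
Qed.

Lemma block_index_integer h (D : set_system nat) : block_index h @ (pt @ D) = h @ D.
Proof.
have e : (fun n => block_index h (pt n)) = h.
  by apply/funext => n; rewrite /block_index ptE Num.Theory.natrK.
by rewrite -[in RHS]e.
Qed.

(** K misses some point q, hence also some open set P that contains
    arbitrarily large points of H.  Cut H at an increasing sequence c of points
    of P and let g n count the cut that follows n.  If B is in g(D), the union
    of the pieces with index in B is decided on K by [connected_cut], and so B
    is in g(E). *)
Lemma proper_continuum_nearly_cohere D E (x y : Hstar R) K :
  nonprincipal_ultrafilter D -> nonprincipal_ultrafilter E ->
  ev @ (pt @ D) --> set_val x -> ev @ (pt @ E) --> set_val y ->
  continuum K -> K <> setT -> K x -> K y -> nearly_cohere D E.
Proof.
move=> Dnp Enp Dx Ey cK KT Kx Ky; have [DU _] := Dnp; have [EU _] := Enp.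
have DN := ((nonprincipal_ultrafilterP D).1 Dnp).2.
have [q nKq] : exists q, ~ K q.
  apply: contrapT => all; apply: KT; apply/seteqP; split=> // q _.
  by apply: contrapT => nKq; apply: all; exists q.
have [P [oP qP KP]] := closed_missed_by_open (continuum_closed Hstar_hausdorff cK) nKq.
have [W [WU Wf Wq]] := Hstar_ultra q.
have /choice[s sP] (b : R) : exists t, P t /\ b < set_val t.
  by have [t [Pt bt]] := filter_ex (filterI (qP W WU Wq) (Wf b)); exists t.
pose c := fix c n := if n is n'.+1 then s (set_val (c n') + 1) else s 0.
have cP n : P (c n) by case: n => [|n]; exact: (sP _).1.
have c_lt n : set_val (c n) + 1 < set_val (c n.+1) by exact: (sP _).2.
have c_gt n : n%:R < set_val (c n).
  by elim: n => [|n IHn]; [exact: (sP 0).2 | rewrite -natr1; have := c_lt n; lra].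
have c_homo m n : (m <= n)%N -> set_val (c m) <= set_val (c n).
  move=> /subnK <-; elim: (n - m)%N => // d IHd; rewrite addSn.
  by have := c_lt (d + m)%N; lra.
have ex (t : H) : exists n, set_val t < set_val (c n).
  by exists (Num.truncn (set_val t)).+1; apply: lt_trans (Num.Theory.truncnS_gt _) (c_gt _).
pose idx t := ex_minn (ex t).
have idx_le t n : set_val t < set_val (c n) -> (idx t <= n)%N.
  by rewrite /idx; case: ex_minnP => m _; apply.
have idx_lt t : set_val t < set_val (c (idx t)) by rewrite /idx; case: ex_minnP.
pose g n := idx (pt n).
have g_bound m n : (g n <= m)%N -> n%:R < set_val (c m).
  by move=> /c_homo; apply: lt_le_trans; rewrite -ptE; exact: idx_lt.
have g_homo : {homo g : m n / (m <= n)%N}.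
  move=> m n mn; apply: idx_le; apply: le_lt_trans (idx_lt (pt n)).
  by rewrite !ptE ler_nat.
have g_fin n : finite_set (g @^-1` [set n]).
  apply: (@sub_finite_set _ _ `I_(Num.truncn (set_val (c n))).+1); last exact: finite_II.
  move=> k /= kn; rewrite -(ltr_nat R).
  apply: lt_trans (Num.Theory.truncnS_gt _); apply: g_bound; rewrite kn.
  exact: leqnn.
have gDnp : nonprincipal_ultrafilter (g @ D).
  apply/nonprincipal_ultrafilterP; split=> [|N]; first exact: ultra_fmap.
  suff : D [set n | (N <= g n)%N] by [].
  apply: filterS (DN (Num.truncn (set_val (c N))).+1) => n /= Nn.
  rewrite leqNgt; apply/negP => /ltnW /g_bound; apply/negP; rewrite -leNgt.
  by apply: le_trans (ltW (Num.Theory.truncnS_gt _)) _; rewrite ler_nat.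
suff gDE : g @ D = g @ E by exists (g @ D); split=> //; exists g; split=> //; rewrite gDE.
apply: ultra_ext => [||B gB]; [exact: ultra_fmap..|].
have lc : locally_constant_off P (idx @^-1` B).
  apply: (@locally_constant_compare R setT (fun n => set_val (c n))).
  - move=> b; exists (Num.truncn b).+1 => k _ ckb; rewrite -(ltr_nat R).
    exact: lt_trans (lt_le_trans (c_gt k) ckb) (Num.Theory.truncnS_gt b).
  - by move=> k t _ /val_inj ->.
  - move=> t u tu; rewrite /=; suff -> : idx t = idx u by [].
    apply/eqP; rewrite eqn_leq; apply/andP; split; apply: idx_le.
    + by have := idx_lt u; have [[]|[]] := tu (idx u) I; lra.
    + by have := idx_lt t; have [[]|[]] := tu (idx t) I; lra.
have coK : connected K by case: cK.
have DU' : UltraFilter (pt @ D) by exact: ultra_fmap.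
have EU' : UltraFilter (pt @ E) by exact: ultra_fmap.
exact: (connected_cut coK oP lc KP DU' EU' Kx Ky Dx Ey gB).
Qed.

(** Take blocks each of which contains a point of the trace P of a small
    neighbourhood: the standard subcontinuum through x contains limits of the
    chosen points of P, and these lie in G. *)
Lemma proper_continua_dense D (x : Hstar R) (G : set (Hstar R)) :
  nonprincipal_ultrafilter D -> ev @ (pt @ D) --> set_val x ->
  open G -> G !=set0 ->
  exists K : set (Hstar R), [/\ continuum K, K <> setT, K x & K `&` G !=set0].
Proof.
move=> Dnp Dx oG [y Gy]; have [DU _] := Dnp.
have cG : closed (~` G) by exact: open_closedC.
have nnGy : ~ (~` G) y by [].
have [P [oP yP GP]] := closed_missed_by_open cG nnGy.
have [V [VU Vf Vy]] := Hstar_ultra y; have VP := yP V VU Vy.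
have /choice[psi psiP] (n : nat) :
    exists k, (n <= k)%N /\ exists2 t : H, P t & Num.truncn (set_val t) = k.
  have [t [Pt nt]] := filter_ex (filterI VP (Vf n%:R)).
  exists (Num.truncn (set_val t)); split; last by exists t.
  by rewrite Num.Theory.truncn_ge_nat ?half_line_val_ge0// ltW.
have [h0 h0b h0psi] := block_map_exists psi.
have hb := block_map_half h0b; set h := (fun n => (h0 n)./2) in hb.
have Fnp := block_map_nonprincipal hb Dnp; have [FU _] := Fnp.
exists (standard_continuum h (h @ D)); split.
- exact: standard_continuum_continuum.
- exact: standard_continuum_proper.
- by rewrite -(block_index_integer h D); apply: standard_continuum_limit => //; exact: ultra_fmap.
have [|W [WU WP WF]] := @ultra_lift H (block_index h) (h @ D) P FU.
  move=> B FB; have [m Bm] := filter_ex FB.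
  have [n nm] : exists n, h0 n = m.*2 by case: h0b => _; exact.
  have [npsi [t Pt tpsi]] := psiP n; exists t => //.
  suff -> : block_index h t = m by [].
  (* psi n lies in the block 2m or 2m+1 of h0, and h merges these two. *)
  have h0le : (h0 n <= h0 (psi n))%N by case: h0b => + _; apply.
  by rewrite /block_index tpsi /h; have := h0psi n; move: h0le; rewrite nm; lia.
have [z Wz] := Hstar_limit WU (block_index_free hb Fnp WU WF).
exists z; split; first by rewrite -WF; exact: standard_continuum_limit.
by apply: contrapT => nGz; exact: (ultraC P WU).1 (GP z W nGz WU Wz) WP.
Qed.

End Integers.

(** Let x and p share the ultrafilter F of indices for the fine blocks h1,
    and let h2 be injective on no set of F.  For a continuum K that contains x
    but not p, the set Q of fine blocks that meet P belongs to F.  The elements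
    of Q that are first, or last, in Q among those with the same h2-value form a
    set on which h2 is injective, which is not in F.  So F-almost every fine
    block lies strictly between two blocks of Q inside the same coarse block,
    and K stays within the coarse blocks of one parity. *)
Lemma ncf_kappa_not_dense (x p : Hstar R) : near_coherence_of_filters ->
  ~ dense (kappa x p).
Proof.
move=> ncf dens.
have [U [UU Uf Ux]] := Hstar_ultra x; have [V [VU Vf Vp]] := Hstar_ultra p.
have Unp := free_truncn_nonprincipal UU Uf.
have Vnp := free_truncn_nonprincipal VU Vf.
have [h1 h1b h1UV] := nearly_cohere_block_map Unp Vnp (ncf _ _ Unp Vnp).
have Fnp := block_map_nonprincipal h1b Unp.
set F := h1 @ _ in h1UV Fnp; have [FU _] := Fnp.
have [h2 h2b h2Q] := ncf_not_q_point ncf Fnp.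
have hb := block_map_comp h1b h2b; set h := (fun n => h2 (h1 n)) in hb.
have [r Fr] := ultra_parity h2 FU.
have [y ny] := parity_outside r hb.
pose M : set (Hstar R) :=
  [set z | closure (ev @` (block_index h @^-1` [set m | odd m = r])) (set_val z)].
have oM : open (~` M).
  apply: closed_openC; apply: closed_comp; last exact: closed_closure.
  by move=> z _; exact: set_val_continuous.
have [|z [nMz kz]] := dens (~` M) _ oM; first by exists y.
apply: nMz; have [K [cK Kx Kz nKp]] := kappa_continuum kz.
have [P [oP pP KP]] := closed_missed_by_open (continuum_closed Hstar_hausdorff cK) nKp.
pose Q : set nat := [set k | exists2 t, P t & block_index h1 t = k].
(* P belongs to every ultrafilter converging to p, which shares F with x. *)
have FQ : F Q.
  rewrite h1UV; suff : V (block_index h1 @^-1` Q) by [].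
  by apply: filterS (pP V VU Vp) => t Pt; exists t.
have /choice[c cQ] (k : nat) : exists t, Q k -> P t /\ block_index h1 t = k.
  have [[t Pt tk]|nQ] := pselect (Q k); first by exists t.
  by have [t _] := filter_ex (pP V VU Vp); exists t.
pose lo : set nat := [set k | exists k', [/\ Q k', (k' < k)%N & h2 k' = h2 k]].
pose hi : set nat := [set k | exists k', [/\ Q k', (k < k')%N & h2 k = h2 k']].
have Flo : F lo.
  have [//|Fn] := in_ultra_setVsetC lo FU.
  have [a [b [[Qa _] [_ nb] ab hab]]] := h2Q _ (filterI FQ Fn).
  by exfalso; apply: nb; exists a.
have Fhi : F hi.
  have [//|Fn] := in_ultra_setVsetC hi FU.
  have [a [b [[_ na] [Qb _] ab hab]]] := h2Q _ (filterI FQ Fn).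
  by exfalso; apply: na; exists b.
pose Z : set H := [set t | exists k k', [/\ Q k, Q k', h2 k = h2 k', odd (h2 k) = r &
  set_val (c k) < set_val t < set_val (c k')]].
have lc : locally_constant_off P Z.
  apply: (@locally_constant_compare R Q (fun k => set_val (c k))).
  - move=> b; exists (h1 (Num.truncn b)).+1 => k Qk ckb; rewrite ltnS.
    have [_ <-] := cQ k Qk; case: h1b => + _; apply; exact: Num.Theory.le_truncn.
  - by move=> k t Qk /val_inj ->; have [] := cQ k Qk.
  - move=> s t st [k [k' [Qk Qk' hkk' kr /andP[ks sk']]]]; exists k, k'; split=> //.
    by apply/andP; split; [have [[]|[]] := st k Qk | have [[]|[]] := st k' Qk']; lra.
have UZ : U Z.
  have UF : U (block_index h1 @^-1` (lo `&` hi `&` [set m | odd (h2 m) = r])).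
    have lhr : F (lo `&` hi `&` [set m | odd (h2 m) = r]).
      by apply: filterI => //; exact: filterI.
    exact: lhr.
  apply: filterS UF => t /= [[[k [Qk kt hk]] [k' [Qk' tk' hk']]] tr].
  exists k, k'; split=> //; [by rewrite hk|by rewrite hk|].
  by apply/andP; split; apply: (half_line_truncn_lt h1b); rewrite (cQ _ _).2.
have [W [WU _ Wz]] := Hstar_ultra z.
have coK : connected K by case: cK.
have WZ := connected_cut coK oP lc KP UU WU Kx Kz Ux Wz UZ.
apply: (ultra_closure WU _ Wz); apply: filterS WZ => t.
move=> [k [k' [Qk Qk' hkk' kr /andP[kt tk']]]] /=.
suff -> : block_index h t = h2 k by [].
have le1 : (k <= block_index h1 t)%N.
  rewrite -{1}(cQ k Qk).2; case: h1b => + _; apply.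
  exact/Num.Theory.le_truncn/ltW.
have le2 : (block_index h1 t <= k')%N.
  rewrite -(cQ k' Qk').2; case: h1b => + _; apply.
  exact/Num.Theory.le_truncn/ltW.
have h2h : {homo h2 : m n / (m <= n)%N} by case: h2b.
by apply/eqP; rewrite eqn_leq {1}hkk' !h2h.
Qed.

End Main.

Theorem corollary4p11 (R : realType) :
  [<-> near_coherence_of_filters;
       exists! C : set (Hstar R), is_composant C;
       (forall x : Hstar R, ~ coastal x) /\ (forall p : Hstar R, ~ non_block p)].
Proof.
have [pt ptE] := @integer_embedding R.
have self_in (x : Hstar R) : composant x x.
  by have [K [cK KT Kx]] := proper_continuum_containing x; exists K.
tfae.
- move=> ncf; have compT (x : Hstar R) : composant x = setT.
    apply/seteqP; split=> // y _.
    by have [K [cK KT Kx Ky]] := ncf_proper_continuum x y ncf; exists K.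
  exists setT; split=> [|C [x ->]]; last by rewrite compT.
  have [x _] : exists x : Hstar R, True.
    have [D [DU FD]] := ultraFilterLemma (_ : ProperFilter \oo).
    have Dnp : nonprincipal_ultrafilter D.
      apply/nonprincipal_ultrafilterP; split=> // N; apply: FD; exact: nbhs_infty_ge.
    by have [x _] := integer_limit ptE Dnp; exists x.
  by exists x; rewrite compT.
- move=> [C [_ uniqC]].
  have comp (x y : Hstar R) : composant x = composant y.
    rewrite -(uniqC (composant x) (ex_intro _ x erefl)).
    exact: uniqC (ex_intro _ y erefl).
  have ncf : near_coherence_of_filters.
    move=> D E Dnp Enp.
    have [x Dx] := integer_limit ptE Dnp; have [y Ey] := integer_limit ptE Enp.
    have [K [cK KT Ky] Kx] : composant y x by rewrite (comp y x).
    exact: (proper_continuum_nearly_cohere ptE Dnp Enp Dx Ey cK KT Kx Ky).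
  by split=> [x [p _]|p [x _]]; exact: ncf_kappa_not_dense.
- move=> [noncoastal _] D E Dnp Enp; apply: contrapT => nDE.
  have [x Dx] := integer_limit ptE Dnp; have [p Ep] := integer_limit ptE Enp.
  have avoid K : continuum K -> K <> setT -> K x -> ~ K p.
    move=> cK KT Kx Kp; apply: nDE.
    exact: (proper_continuum_nearly_cohere ptE Dnp Enp Dx Ep cK KT Kx Kp).
  apply: (noncoastal x); exists p.
    move=> xp; have [K [cK KT Kx]] := proper_continuum_containing x.
    by apply: (avoid K cK KT Kx); rewrite -xp.
  move=> G G0 oG.
  have [K [cK KT Kx [z [Kz Gz]]]] := proper_continua_dense ptE Dnp Dx oG G0.
  exists z; split=> //.
  exact: (continuum_sub_kappa Hstar_hausdorff cK Kx (avoid K cK KT Kx)).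
Qed.
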